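(* Let $\mathcal{A}$ be a multiring category over $k$ and let $\mathcal{C}$ be a two-sided Serre tensor-ideal of $\mathcal{A}$. Then $\mathcal{A}/\mathcal{C}$, with the monoidal structure induced from $\mathcal{A}$ (as defined in the context), is a multiring category over $k$.
   Context: $k$ is an algebraically closed field. A $k$-linear abelian category is locally finite if all its Hom spaces are finite dimensional over $k$ and every object has finite length. A multiring category over $k$ is a locally finite $k$-linear abelian monoidal category whose tensor product is bilinear (on morphisms) and biexact. A Serre subcategory of an abelian category $\mathcal{A}$ is a full additive subcategory closed under subobjects, quotients and extensions. The quotient category $\mathcal{A}/\mathcal{C}$ has the same objects as $\mathcal{A}$, and $\mathrm{Hom}_{\mathcal{A}/\mathcal{C}}(M,N)=\varinjlim_{M',N'}\mathrm{Hom}_{\mathcal{A}}(M',N/N')$, where $M'\subset M$ and $N'\subset N$ run over the subobjects with $M/M'\in\mathcal{C}$ and $N'\in\mathcal{C}$; $T:\mathcal{A}\to\mathcal{A}/\mathcal{C}$ is the canonical functor. For $f:M'\to N/N'$ in this direct system, the morphism $M\to N$ of $\mathcal{A}/\mathcal{C}$ represented by $f$ is also written $Tf$; every morphism of $\mathcal{A}/\mathcal{C}$ is of this form. A two-sided Serre tensor-ideal of an abelian monoidal category $\mathcal{A}$ is a Serre subcategory $\mathcal{C}$ such that $X\otimes Y\in\mathcal{C}$ and $Y\otimes X\in\mathcal{C}$ for all $X\in\mathcal{A}$, $Y\in\mathcal{C}$. Monoidal structure on $\mathcal{A}/\mathcal{C}$ (for $\mathcal{A}$ with biexact tensor product): the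 tensor product of objects is that of $\mathcal{A}$, and the unit object is that of $\mathcal{A}$. If $\bar f=Tf:M\to N$ and $\bar g=Tg:X\to Y$ are morphisms of $\mathcal{A}/\mathcal{C}$, represented by $f:M'\to N/N'$ and $g:X'\to Y/Y'$, then $\bar f\otimes\bar g:=T(f\otimes g):M\otimes X\to N\otimes Y$ is the morphism of $\mathcal{A}/\mathcal{C}$ represented by $f\otimes g:M'\otimes X'\to (N/N')\otimes(Y/Y')$, where $M'\otimes X'$ is regarded as a subobject of $M\otimes X$ and $(N/N')\otimes(Y/Y')$ as a quotient of $N\otimes Y$; this is well defined. The associativity constraint is $\bar a_{X,Y,Z}=T(a_{X,Y,Z})$ and the left and right unit isomorphisms are $T(l_X)$, $T(r_X)$, where $a,l,r$ are those of $\mathcal{A}$. *)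

(* Defs.v *)
From HB Require Import structures.
From mathcomp Require Import all_boot all_algebra boolp.

Set Implicit Arguments.
Unset Strict Implicit.
Unset Printing Implicit Defensive.

Import GRing.Theory.
Local Open Scope ring_scope.
Local Open Scope quotient_scope.

Declare Scope cat_scope.
Delimit Scope cat_scope with cat.
Local Open Scope cat_scope.

(* The data of a category whose Hom spaces are k-modules; the laws are
   collected in [is_linear_cat]. *)
Record precat (k : fieldType) := Precat {
  ob :> Type;
  hom : ob -> ob -> lmodType k;
  idm : forall x, hom x x;
  comp : forall x y z, hom y z -> hom x y -> hom x z }.

Arguments hom {k p} x y : rename.
Arguments idm {k p} x : rename.
Arguments comp {k p x y z} g f : rename.

Notation "g ∘ f" := (comp g f) (at level 40, left associativity) : cat_scope.

Record is_linear_cat (k : fieldType) (A : precat k) : Prop := IsLinearCat {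
  cat_compA : forall (w x y z : A) (h : hom y z) (g : hom x y) (f : hom w x),
    h ∘ (g ∘ f) = h ∘ g ∘ f;
  cat_comp1f : forall (x y : A) (f : hom x y), idm y ∘ f = f;
  cat_compf1 : forall (x y : A) (f : hom x y), f ∘ idm x = f;
  cat_linl : forall (x y z : A) (f : hom x y),
    linear (fun g : hom y z => g ∘ f);
  cat_linr : forall (x y z : A) (g : hom y z),
    linear (fun f : hom x y => g ∘ f) }.

Section Notions.
Variables (k : fieldType) (A : precat k).

Definition is_mono (x y : A) (f : hom x y) : Prop :=
  forall w (g1 g2 : hom w x), f ∘ g1 = f ∘ g2 -> g1 = g2.

Definition is_epi (x y : A) (f : hom x y) : Prop :=
  forall w (g1 g2 : hom y w), g1 ∘ f = g2 ∘ f -> g1 = g2.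

Definition is_iso (x y : A) (f : hom x y) : Prop :=
  exists g : hom y x, g ∘ f = idm x /\ f ∘ g = idm y.

Definition is_zero_ob (z : A) : Prop :=
  forall x, (forall f : hom x z, f = 0) /\ (forall f : hom z x, f = 0).

Definition is_kernel (x y w : A) (f : hom x y) (j : hom w x) : Prop :=
  f ∘ j = 0 /\
  forall v (t : hom v x), f ∘ t = 0 -> exists! s : hom v w, j ∘ s = t.

Definition is_cokernel (x y w : A) (f : hom x y) (c : hom y w) : Prop :=
  c ∘ f = 0 /\
  forall v (t : hom y v), t ∘ f = 0 -> exists! s : hom w v, s ∘ c = t.

Definition is_biproduct (x y s : A) : Prop :=
  exists (i1 : hom x s) (i2 : hom y s) (p1 : hom s x) (p2 : hom s y),
    [/\ p1 ∘ i1 = idm x, p2 ∘ i2 = idm y, p1 ∘ i2 = 0, p2 ∘ i1 = 0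
      & i1 ∘ p1 + i2 ∘ p2 = idm s].

(* 0 -> x -i-> y -p-> z -> 0 *)
Definition short_exact (x y z : A) (i : hom x y) (p : hom y z) : Prop :=
  is_kernel p i /\ is_cokernel i p.

Record is_linear_abelian : Prop := IsLinearAbelian {
  ab_linear :> is_linear_cat A;
  ab_zero : exists z : A, is_zero_ob z;
  ab_biproduct : forall x y : A, exists s, is_biproduct x y s;
  ab_kernel : forall (x y : A) (f : hom x y),
    exists w (j : hom w x), is_kernel f j;
  ab_cokernel : forall (x y : A) (f : hom x y),
    exists w (c : hom y w), is_cokernel f c;
  ab_mono_normal : forall (x y : A) (f : hom x y), is_mono f ->
    exists w (g : hom y w), is_kernel g f;
  ab_epi_normal : forall (x y : A) (f : hom x y), is_epi f ->
    exists w (g : hom w x), is_cokernel g f }.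

Definition is_simple (s : A) : Prop :=
  ~ is_zero_ob s /\
  forall x (i : hom x s), is_mono i -> is_zero_ob x \/ is_iso i.

(* Existence of a composition series, built up from 0 by simple quotients. *)
Inductive finite_length : A -> Prop :=
| FiniteLength0 z : is_zero_ob z -> finite_length z
| FiniteLengthS y x s (i : hom y x) (p : hom x s) :
    short_exact i p -> is_simple s -> finite_length y -> finite_length x.

Record is_locally_finite : Prop := IsLocallyFinite {
  lf_hom : forall x y : A, exists n, inhabited (Vector.axiom n (hom x y));
  lf_length : forall x : A, finite_length x }.

(* A full subcategory is given by a predicate on objects. *)
Record is_serre (C : A -> Prop) : Prop := IsSerre {
  serre_zero : forall z, is_zero_ob z -> C z;
  serre_biproduct : forall x y s, is_biproduct x y s -> C x -> C y -> C s;
  serre_sub : forall x y (i : hom x y), is_mono i -> C y -> C x;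
  serre_quot : forall x y (p : hom x y), is_epi p -> C x -> C y;
  serre_ext : forall x y z (i : hom x y) (p : hom y z),
    short_exact i p -> C x -> C z -> C y }.

End Notions.

Record premonoidal (k : fieldType) := Premonoidal {
  mon_cat :> precat k;
  unit_ob : mon_cat;
  tens : mon_cat -> mon_cat -> mon_cat;
  tensm : forall x1 y1 x2 y2 : mon_cat,
    hom x1 y1 -> hom x2 y2 -> hom (tens x1 x2) (tens y1 y2);
  assoc : forall x y z : mon_cat, hom (tens (tens x y) z) (tens x (tens y z));
  lunit : forall x : mon_cat, hom (tens unit_ob x) x;
  runit : forall x : mon_cat, hom (tens x unit_ob) x }.

Arguments unit_ob {k p} : rename.
Arguments tens {k p} x y : rename.
Arguments tensm {k p x1 y1 x2 y2} f g : rename.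
Arguments assoc {k p} x y z : rename.
Arguments lunit {k p} x : rename.
Arguments runit {k p} x : rename.

Notation "x ⊗ y" := (tens x y) (at level 39, left associativity) : cat_scope.
Notation "f ⊠ g" := (tensm f g) (at level 39, left associativity) : cat_scope.

Section Monoidal.
Variables (k : fieldType) (A : premonoidal k).

Record is_monoidal : Prop := IsMonoidal {
  tens_id : forall x y : A, idm x ⊠ idm y = idm (x ⊗ y);
  tens_comp : forall (x1 y1 z1 x2 y2 z2 : A) (g1 : hom y1 z1) (f1 : hom x1 y1)
      (g2 : hom y2 z2) (f2 : hom x2 y2),
    (g1 ∘ f1) ⊠ (g2 ∘ f2) = (g1 ⊠ g2) ∘ (f1 ⊠ f2);
  assoc_nat : forall (x1 y1 x2 y2 x3 y3 : A) (f1 : hom x1 y1) (f2 : hom x2 y2)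
      (f3 : hom x3 y3),
    assoc y1 y2 y3 ∘ ((f1 ⊠ f2) ⊠ f3) = (f1 ⊠ (f2 ⊠ f3)) ∘ assoc x1 x2 x3;
  lunit_nat : forall (x y : A) (f : hom x y),
    lunit y ∘ (idm unit_ob ⊠ f) = f ∘ lunit x;
  runit_nat : forall (x y : A) (f : hom x y),
    runit y ∘ (f ⊠ idm unit_ob) = f ∘ runit x;
  assoc_iso : forall x y z : A, is_iso (assoc x y z);
  lunit_iso : forall x : A, is_iso (lunit x);
  runit_iso : forall x : A, is_iso (runit x);
  pentagon : forall w x y z : A,
    (idm w ⊠ assoc x y z) ∘ assoc w (x ⊗ y) z ∘ (assoc w x y ⊠ idm z) =
    assoc w x (y ⊗ z) ∘ assoc (w ⊗ x) y z;
  triangle : forall x y : A,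
    (idm x ⊠ lunit y) ∘ assoc x unit_ob y = runit x ⊠ idm y }.

Definition tensor_bilinear : Prop :=
  (forall (x1 y1 x2 y2 : A) (g : hom x2 y2),
     linear (fun f : hom x1 y1 => f ⊠ g)) /\
  (forall (x1 y1 x2 y2 : A) (f : hom x1 y1),
     linear (fun g : hom x2 y2 => f ⊠ g)).

(* With bilinearity, this says that - ⊗ w and w ⊗ - are exact functors. *)
Definition tensor_biexact : Prop :=
  forall (w x y z : A) (i : hom x y) (p : hom y z), short_exact i p ->
    short_exact (i ⊠ idm w) (p ⊠ idm w) /\
    short_exact (idm w ⊠ i) (idm w ⊠ p).

Record is_multiring : Prop := IsMultiring {
  mr_abelian :> is_linear_abelian A;
  mr_locally_finite : is_locally_finite A;
  mr_monoidal : is_monoidal;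
  mr_bilinear : tensor_bilinear;
  mr_biexact : tensor_biexact }.

Record is_serre_tensor_ideal (C : A -> Prop) : Prop := IsSerreTensorIdeal {
  ideal_serre :> is_serre C;
  ideal_tens : forall x y : A, C y -> C (x ⊗ y) /\ C (y ⊗ x) }.

End Monoidal.

Section Fractions.
Variables (k : fieldType) (A : precat k) (C : A -> Prop).

(* Monomorphisms i with coker(i) in C, and epimorphisms p with ker(p) in C. *)
Definition mono_modC (x y : A) (i : hom x y) : Prop :=
  is_mono i /\ exists w (c : hom y w), is_cokernel i c /\ C w.

Definition epi_modC (x y : A) (p : hom x y) : Prop :=
  is_epi p /\ exists w (j : hom w x), is_kernel p j /\ C w.

(* A member f : M' -> N/N' of the direct system defining Hom_(A/C)(M, N):
   [finc] is the inclusion of M' = [fdom] in M, and [fprj] is the projection of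
   N onto N/N' = [fcod], so that N' is the kernel of [fprj]. *)
Record frac (M N : A) := Frac {
  fdom : A;
  fcod : A;
  finc : hom fdom M;
  fprj : hom N fcod;
  fmap : hom fdom fcod;
  finc_modC : mono_modC finc;
  fprj_modC : epi_modC fprj }.

(* [s] is the image of [r] under a transition map of the direct system. *)
Definition frac_le (M N : A) (r s : frac M N) : Prop :=
  exists (u : hom (fdom s) (fdom r)) (w : hom (fcod r) (fcod s)),
    [/\ finc s = finc r ∘ u, fprj s = w ∘ fprj r & fmap s = w ∘ fmap r ∘ u].

Definition frac_eq (M N : A) (r s : frac M N) : Prop :=
  exists t, frac_le r t /\ frac_le s t.

(* The sum of two fractions, taken at a common stage of the direct system. *)
Definition frac_sum (M N : A) (r s t : frac M N) : Prop :=
  exists (u1 : hom (fdom t) (fdom r)) (w1 : hom (fcod r) (fcod t))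
         (u2 : hom (fdom t) (fdom s)) (w2 : hom (fcod s) (fcod t)),
    [/\ finc t = finc r ∘ u1 /\ fprj t = w1 ∘ fprj r,
        finc t = finc s ∘ u2 /\ fprj t = w2 ∘ fprj s
      & fmap t = w1 ∘ fmap r ∘ u1 + w2 ∘ fmap s ∘ u2].

(* Gabriel's composition of f : M' -> N/N' and g : N1 -> P/P'. With
   I = (N1 + N')/N' = N1/(N1 /\ N'), the image of N1 -> N -> N/N', shrink M'
   into the preimage of I and enlarge P' so that it contains g(N1 /\ N'); then f
   and g induce [v] : _ -> I and [g'] : I -> _ and the composite is g' v. *)
Definition frac_comp (M N P : A) (g : frac N P) (f : frac M N)
    (h : frac M P) : Prop :=
  exists (I : A) (e : hom (fdom g) I) (m : hom I (fcod f))
         (u : hom (fdom h) (fdom f)) (v : hom (fdom h) I)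
         (w : hom (fcod g) (fcod h)) (g' : hom I (fcod h)),
    [/\ [/\ is_epi e, is_mono m & m ∘ e = fprj f ∘ finc g],
        finc h = finc f ∘ u /\ fprj h = w ∘ fprj g,
        m ∘ v = fmap f ∘ u,
        g' ∘ e = w ∘ fmap g
      & fmap h = g' ∘ v].

End Fractions.

Definition opcat (k : fieldType) (A : precat k) : precat k :=
  @Precat k A (fun x y => hom y x) (fun x => idm x) (fun x y z g f => f ∘ g).

Lemma opcat_linear (k : fieldType) (A : precat k) :
  is_linear_cat A -> is_linear_cat (opcat A).
Proof.
case=> cA c1f cf1 ll lr; split=> /=.
- by move=> w x y z h g f; rewrite -cA.
- by move=> x y f; exact: cf1.
- by move=> x y f; exact: c1f.
- by move=> x y z f; exact: lr.
- by move=> x y z f; exact: ll.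
Qed.

Lemma opcat_abelian (k : fieldType) (A : precat k) :
  is_linear_abelian A -> is_linear_abelian (opcat A).
Proof.
case=> lin [z hz] bip ker cok mn en; split.
- exact: opcat_linear.
- by exists z => x; case: (hz x).
- move=> x y; have [s [i1 [i2 [p1 [p2 [h1 h2 h3 h4 h5]]]]]] := bip x y.
  by exists s, p1, p2, i1, i2; split.
- by move=> x y f; exact: (cok y x f).
- by move=> x y f; exact: (ker y x f).
- by move=> x y f; exact: (en y x f).
- by move=> x y f; exact: (mn y x f).
Qed.

Lemma opcat_serre (k : fieldType) (A : precat k) (C : A -> Prop) :
  is_serre C -> @is_serre k (opcat A) C.
Proof.
case=> s0 sb ss sq se; split.
- by move=> z hz; apply: s0 => x; case: (hz x).
- move=> x y s [i1 [i2 [p1 [p2 [h1 h2 h3 h4 h5]]]]]; apply: sb.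
  by exists p1, p2, i1, i2; split.
- by move=> x y i; exact: (sq y x i).
- by move=> x y i; exact: (ss y x i).
- by move=> x y z i p [ki cp] Cx Cz; exact: (se z y x p i).
Qed.

Section LinearTheory.
Variables (k : fieldType) (A : precat k).
Hypothesis hA : is_linear_cat A.
Implicit Types x y z w : A.

Let compA := cat_compA hA.

Lemma comp0f x y z (f : hom x y) : (0 : hom y z) ∘ f = 0.
Proof.
have := cat_linl hA (z := z) f (-1) 0 0.
by rewrite /= scaleN1r oppr0 addr0 scaleN1r addNr.
Qed.

Lemma compf0 x y z (g : hom y z) : g ∘ (0 : hom x y) = 0.
Proof.
have := cat_linr hA (x := x) g (-1) 0 0.
by rewrite /= scaleN1r oppr0 addr0 scaleN1r addNr.
Qed.

Lemma compDf x y z (g g' : hom y z) (f : hom x y) :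
  (g + g') ∘ f = g ∘ f + g' ∘ f.
Proof. by have := cat_linl hA f 1 g g'; rewrite !scale1r. Qed.

Lemma compfD x y z (g : hom y z) (f f' : hom x y) :
  g ∘ (f + f') = g ∘ f + g ∘ f'.
Proof. by have := cat_linr hA g 1 f f'; rewrite !scale1r. Qed.

Lemma compZf x y z a (g : hom y z) (f : hom x y) : (a *: g) ∘ f = a *: (g ∘ f).
Proof. by have := cat_linl hA f a g 0; rewrite comp0f !addr0. Qed.

Lemma compfZ x y z a (g : hom y z) (f : hom x y) : g ∘ (a *: f) = a *: (g ∘ f).
Proof. by have := cat_linr hA g a f 0; rewrite compf0 !addr0. Qed.

Lemma compNf x y z (g : hom y z) (f : hom x y) : (- g) ∘ f = - (g ∘ f).
Proof. by rewrite -scaleN1r compZf scaleN1r. Qed.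

Lemma compfN x y z (g : hom y z) (f : hom x y) : g ∘ (- f) = - (g ∘ f).
Proof. by rewrite -scaleN1r compfZ scaleN1r. Qed.

Lemma mono0P x y (f : hom x y) :
  (forall w (t : hom w x), f ∘ t = 0 -> t = 0) -> is_mono f.
Proof.
move=> h w t1 t2 e; apply/eqP; rewrite -subr_eq0; apply/eqP; apply: h.
by rewrite compfD compfN e subrr.
Qed.

Lemma mono_eq0 x y w (f : hom x y) (t : hom w x) :
  is_mono f -> f ∘ t = 0 -> t = 0.
Proof. by move=> mf e; apply: mf; rewrite e compf0. Qed.

Lemma mono_comp x y z (g : hom y z) (f : hom x y) :
  is_mono g -> is_mono f -> is_mono (g ∘ f).
Proof. by move=> mg mf w t1 t2; rewrite -!compA => /mg/mf. Qed.

Lemma mono_compr x y z (g : hom y z) (f : hom x y) :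
  is_mono (g ∘ f) -> is_mono f.
Proof. by move=> m w t1 t2 e; apply: m; rewrite -!compA e. Qed.

Lemma kernel_mono x y w (f : hom x y) (j : hom w x) : is_kernel f j -> is_mono j.
Proof.
move=> [fj h] v t1 t2 e.
have f0 : f ∘ (j ∘ t2) = 0 by rewrite compA fj comp0f.
by have [s [_ us]] := h _ _ f0; rewrite -(us t1 e) (us t2).
Qed.

Lemma kernel_lift x y w v (f : hom x y) (j : hom w x) (t : hom v x) :
  is_kernel f j -> f ∘ t = 0 -> exists s : hom v w, j ∘ s = t.
Proof. by move=> [_ h] /h [s [e _]]; exists s. Qed.

Lemma kernelP x y w (f : hom x y) (j : hom w x) : is_mono j -> f ∘ j = 0 ->
  (forall v (t : hom v x), f ∘ t = 0 -> exists s : hom v w, j ∘ s = t) ->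
  is_kernel f j.
Proof.
move=> mj e h; split=> // v t /h [s es]; exists s; split=> // s' es'.
by apply: mj; rewrite es es'.
Qed.

End LinearTheory.

Section LinearDual.
Variables (k : fieldType) (A : precat k).
Hypothesis hA : is_linear_cat A.
Implicit Types x y z w : A.

Let hAop := opcat_linear hA.

Lemma epi0P x y (f : hom x y) :
  (forall w (t : hom y w), t ∘ f = 0 -> t = 0) -> is_epi f.
Proof. exact: (mono0P hAop). Qed.

Lemma epi_eq0 x y w (f : hom x y) (t : hom y w) :
  is_epi f -> t ∘ f = 0 -> t = 0.
Proof. exact: (mono_eq0 hAop). Qed.

Lemma epi_comp x y z (g : hom y z) (f : hom x y) :
  is_epi g -> is_epi f -> is_epi (g ∘ f).
Proof. by move=> eg ef; exact: (mono_comp hAop ef eg). Qed.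

Lemma epi_compl x y z (g : hom y z) (f : hom x y) :
  is_epi (g ∘ f) -> is_epi g.
Proof. exact: (mono_compr hAop). Qed.

Lemma cokernel_epi x y w (f : hom x y) (c : hom y w) :
  is_cokernel f c -> is_epi c.
Proof. exact: (kernel_mono hAop). Qed.

Lemma cokernel_desc x y w v (f : hom x y) (c : hom y w) (t : hom y v) :
  is_cokernel f c -> t ∘ f = 0 -> exists s : hom w v, s ∘ c = t.
Proof. by move=> [_ h] /h [s [e _]]; exists s. Qed.

Lemma cokernelP x y w (f : hom x y) (c : hom y w) : is_epi c -> c ∘ f = 0 ->
  (forall v (t : hom y v), t ∘ f = 0 -> exists s : hom w v, s ∘ c = t) ->
  is_cokernel f c.
Proof. exact: (kernelP (A := opcat A)). Qed.

End LinearDual.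

Section AbelianTheory.
Variables (k : fieldType) (A : precat k).
Hypothesis hA : is_linear_abelian A.
Implicit Types x y z w : A.

Let hL : is_linear_cat A := hA.
Let compA := cat_compA hL.

Lemma mono_kernel x y z (i : hom x y) (c : hom y z) :
  is_mono i -> is_cokernel i c -> is_kernel c i.
Proof.
move=> mi kc; have [w [h kh]] := ab_mono_normal hA mi.
apply: kernelP => //; first by case: kc.
move=> v t ct; apply: (kernel_lift kh).
have [h' <-] := cokernel_desc kc kh.1.
by rewrite -compA ct (compf0 hL).
Qed.

Lemma image_mono x y z w (f : hom x y) (j : hom w x) (c : hom x z)
  (m : hom z y) : is_kernel f j -> is_cokernel j c -> m ∘ c = f -> is_mono m.
Proof.
move=> kj kc mc; apply: (mono0P hL) => v t mt.
have [q [d kd]] := ab_cokernel hA t.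
have [m' m'd] := cokernel_desc kd mt.
have edc : is_epi (d ∘ c).
  exact: (epi_comp hL (cokernel_epi hL kd) (cokernel_epi hL kc)).
have [u [h kh]] := ab_epi_normal hA edc.
have fh : f ∘ h = 0.
  by rewrite -mc -m'd -(compA m') -(compA m') kh.1 (compf0 hL).
have [h' jh'] := kernel_lift kj fh.
have ch : c ∘ h = 0 by rewrite -jh' compA kc.1 (comp0f hL).
have [s sdc] := cokernel_desc kh ch.
have sd : s ∘ d = idm z.
  apply: (cokernel_epi hL kc).
  by rewrite -compA sdc (cat_comp1f hL).
by rewrite -(cat_comp1f hL t) -sd -compA kd.1 (compf0 hL).
Qed.

Lemma image_ex x y (f : hom x y) : exists I (e : hom x I) (m : hom I y),
  [/\ is_epi e, is_mono m & m ∘ e = f].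
Proof.
have [w [j kj]] := ab_kernel hA f.
have [I [e ke]] := ab_cokernel hA j.
have [m me] := cokernel_desc ke kj.1.
exists I, e, m; split=> //; first exact: (cokernel_epi hL ke).
exact: (image_mono kj ke me).
Qed.

End AbelianTheory.

Section ModC.
Variables (k : fieldType) (A : precat k) (C : A -> Prop).
Hypothesis hA : is_linear_abelian A.
Hypothesis hC : is_serre C.
Implicit Types x y z w : A.

Let hL : is_linear_cat A := hA.
Let compA := cat_compA hL.

Lemma kernel_modC x y w (f : hom x y) (j : hom w x) :
  is_kernel f j -> C y -> mono_modC C j.
Proof.
move=> kj Cy; split; first exact: (kernel_mono hL kj).
have [z [c kc]] := ab_cokernel hA j.
exists z, c; split=> //.
have [m mc] := cokernel_desc kc kj.1.
exact: (serre_sub hC (image_mono hA kj kc mc)).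
Qed.

Lemma mono_modC_kernel x y (i : hom x y) :
  mono_modC C i -> exists z (c : hom y z), [/\ is_kernel c i, is_epi c & C z].
Proof.
move=> [mi [z [c [kc Cz]]]]; exists z, c; split=> //.
  exact: (mono_kernel hA mi kc).
exact: (cokernel_epi hL kc).
Qed.

Lemma mono_modC_comp x y z (i : hom y z) (j : hom x y) :
  mono_modC C i -> mono_modC C j -> mono_modC C (i ∘ j).
Proof.
move=> [mi [p [c [kc Cp]]]] [mj [q [d [kd Cq]]]].
split; first exact: (mono_comp hL).
have [r [b kb]] := ab_cokernel hA (i ∘ j).
exists r, b; split=> //.
have bij : b ∘ i ∘ j = 0 by rewrite -compA kb.1.
have [a ad] := cokernel_desc kd bij.
have cij : c ∘ (i ∘ j) = 0 by rewrite compA kc.1 (comp0f hL).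
have [b' b'b] := cokernel_desc kb cij.
have [I [e [m [ee em me]]]] := image_ex hA a.
have CI : C I := serre_quot hC ee Cq.
have ed := cokernel_epi hL kd.
have ek : is_cokernel m b'.
  apply: cokernelP.
  - by apply: (epi_compl hL (f := b)); rewrite b'b; exact: (cokernel_epi hL kc).
  - apply: (epi_eq0 hL (f := e ∘ d)); first exact: (epi_comp hL).
    by rewrite -(compA b') (compA m) me ad (compA b') b'b kc.1.
  - move=> v t tm.
    have tbi : t ∘ b ∘ i = 0.
      by rewrite -compA -ad -me -(compA m) (compA t) tm (comp0f hL).
    have [s sc] := cokernel_desc kc tbi.
    exists s; apply: (cokernel_epi hL kb).
    by rewrite -compA b'b sc.
by apply: (serre_ext hC (i := m) (p := b')) => //; split=> //; exact: mono_kernel.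
Qed.

Lemma mono_modC_cap x y z (i : hom x z) (j : hom y z) :
  mono_modC C i -> mono_modC C j ->
  exists w (u : hom w x) (v : hom w y), i ∘ u = j ∘ v /\ mono_modC C (i ∘ u).
Proof.
move=> /mono_modC_kernel [p [c [kc ec Cp]]] /mono_modC_kernel [q [d [kd ed Cq]]].
have [s hs] := ab_biproduct hA p q.
have Cs : C s := serre_biproduct hC hs Cp Cq.
have [i1 [i2 [p1 [p2 [h11 h22 h12 h21 _]]]]] := hs.
have [w [l kl]] := ab_kernel hA (i1 ∘ c + i2 ∘ d).
have cl : c ∘ l = 0.
  have := congr1 (fun t => p1 ∘ t) kl.1.
  rewrite (compf0 hL) compA (compfD hL) !compA h11 h12 (comp0f hL) addr0.
  by rewrite (cat_comp1f hL).
have dl : d ∘ l = 0.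
  have := congr1 (fun t => p2 ∘ t) kl.1.
  rewrite (compf0 hL) compA (compfD hL) !compA h21 h22 (comp0f hL) add0r.
  by rewrite (cat_comp1f hL).
have [u eu] := kernel_lift kc cl; have [v ev] := kernel_lift kd dl.
by exists w, u, v; rewrite eu ev; split=> //; exact: kernel_modC kl Cs.
Qed.

Lemma mono_modC_pull x y z (f : hom x z) (m : hom y z) : mono_modC C m ->
  exists w (u : hom w x) (v : hom w y), mono_modC C u /\ m ∘ v = f ∘ u.
Proof.
move=> /mono_modC_kernel [p [c [kc ec Cp]]].
have [w [u ku]] := ab_kernel hA (c ∘ f).
have cfu : c ∘ (f ∘ u) = 0 by rewrite compA ku.1.
have [v ev] := kernel_lift kc cfu.
by exists w, u, v; split=> //; exact: kernel_modC ku Cp.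
Qed.

Lemma mono_modC_image x y z I (i : hom x y) (p : hom y z) (e : hom x I)
  (m : hom I z) : mono_modC C i -> is_epi p -> is_epi e -> is_mono m ->
  m ∘ e = p ∘ i -> mono_modC C m.
Proof.
move=> [mi [q [c [kc Cq]]]] ep ee em eq; split=> //.
have [r [b kb]] := ab_cokernel hA m.
exists r, b; split=> //.
have bpi : b ∘ p ∘ i = 0 by rewrite -compA -eq compA kb.1 (comp0f hL).
have [t tc] := cokernel_desc kc bpi.
apply: (serre_quot hC (p := t)) => //.
apply: (epi_compl hL (f := c)); rewrite tc.
by apply: (epi_comp hL) => //; exact: (cokernel_epi hL kb).
Qed.

Lemma mono_modC_id x : mono_modC C (idm x).
Proof.
split; first by move=> w t1 t2; rewrite !(cat_comp1f hL).
have [z hz] := ab_zero hA.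
exists z, 0; split; last exact: serre_zero hC _ hz.
split; first by rewrite (comp0f hL).
move=> v t; rewrite (cat_compf1 hL) => ->; exists 0; split.
  by rewrite (comp0f hL).
by move=> s _; rewrite ((hz v).2 s).
Qed.

End ModC.

Section ModCDual.
Variables (k : fieldType) (A : precat k) (C : A -> Prop).
Hypothesis hA : is_linear_abelian A.
Hypothesis hC : is_serre C.
Implicit Types x y z w : A.

Let hAop := opcat_abelian hA.
Let hCop := opcat_serre hC.

Lemma epi_modC_comp x y z (p : hom y z) (q : hom x y) :
  epi_modC C p -> epi_modC C q -> epi_modC C (p ∘ q).
Proof. by move=> hp hq; exact: (mono_modC_comp hAop hCop hq hp). Qed.

Lemma epi_modC_cup x y z (p : hom z x) (q : hom z y) :
  epi_modC C p -> epi_modC C q ->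
  exists w (u : hom x w) (v : hom y w), u ∘ p = v ∘ q /\ epi_modC C (u ∘ p).
Proof. exact: (mono_modC_cap hAop hCop). Qed.

Lemma epi_modC_push x y z (f : hom z x) (e : hom z y) : epi_modC C e ->
  exists w (u : hom x w) (v : hom y w), epi_modC C u /\ v ∘ e = u ∘ f.
Proof. exact: (mono_modC_pull hAop hCop). Qed.

Lemma epi_modC_image x y z I (i : hom x y) (p : hom y z) (e : hom x I)
  (m : hom I z) : epi_modC C p -> is_mono i -> is_mono m -> is_epi e ->
  m ∘ e = p ∘ i -> epi_modC C e.
Proof. exact: (mono_modC_image hAop hCop). Qed.

Lemma epi_modC_id x : epi_modC C (idm x).
Proof. exact: (mono_modC_id hAop hCop). Qed.

End ModCDual.

Section FractionTheory.
Variables (k : fieldType) (A : precat k) (C : A -> Prop).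
Hypothesis hA : is_linear_abelian A.
Hypothesis hC : is_serre C.
Implicit Types M N P : A.

Let hL : is_linear_cat A := hA.
Let compA := cat_compA hL.

Lemma frac_le_refl M N (r : frac C M N) : frac_le r r.
Proof.
by exists (idm _), (idm _); rewrite !(cat_compf1 hL) !(cat_comp1f hL).
Qed.

Lemma frac_le_trans M N (s r t : frac C M N) :
  frac_le r s -> frac_le s t -> frac_le r t.
Proof.
move=> [u [w [e1 e2 e3]]] [u' [w' [e1' e2' e3']]].
exists (u ∘ u'), (w' ∘ w); split.
- by rewrite e1' e1 compA.
- by rewrite e2' e2 compA.
- by rewrite e3' e3 !compA.
Qed.

Lemma common_stage M N (r s : frac C M N) :
  exists (D Q : A) (i : hom D M) (p : hom N Q)
         (u1 : hom D (fdom r)) (w1 : hom (fcod r) Q)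
         (u2 : hom D (fdom s)) (w2 : hom (fcod s) Q),
    [/\ mono_modC C i, epi_modC C p, i = finc r ∘ u1 /\ p = w1 ∘ fprj r
      & i = finc s ∘ u2 /\ p = w2 ∘ fprj s].
Proof.
have [D [u1 [u2 [eu hu]]]] := mono_modC_cap hA hC (finc_modC r) (finc_modC s).
have [Q [w1 [w2 [ew hw]]]] := epi_modC_cup hA hC (fprj_modC r) (fprj_modC s).
by exists D, Q, (finc r ∘ u1), (w1 ∘ fprj r), u1, w1, u2, w2.
Qed.

Lemma frac_le_join M N (s t1 t2 : frac C M N) : frac_le s t1 -> frac_le s t2 ->
  exists t, frac_le t1 t /\ frac_le t2 t.
Proof.
move=> [a1 [b1 [ea1 eb1 ef1]]] [a2 [b2 [ea2 eb2 ef2]]].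
have [D [Q [i [p [u1 [w1 [u2 [w2 [hi hp [ei1 ep1] [ei2 ep2]]]]]]]]]] :=
  common_stage t1 t2.
have eu : a1 ∘ u1 = a2 ∘ u2.
  by apply: (finc_modC s).1; rewrite !compA -ea1 -ea2 -ei1.
have ew : w1 ∘ b1 = w2 ∘ b2.
  by apply: (fprj_modC s).1; rewrite -!compA -eb1 -eb2 -ep1.
exists (Frac (w1 ∘ fmap t1 ∘ u1) hi hp); split.
  by exists u1, w1.
exists u2, w2; split=> //=.
by rewrite ef1 ef2 !compA ew -(compA _ a1) -(compA _ a2) eu.
Qed.

Lemma frac_eq_refl M N (r : frac C M N) : frac_eq r r.
Proof. by exists r; split; exact: frac_le_refl. Qed.

Lemma frac_eq_sym M N (r s : frac C M N) : frac_eq r s -> frac_eq s r.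
Proof. by case=> t [h1 h2]; exists t. Qed.

Lemma frac_eq_trans M N (s r t : frac C M N) :
  frac_eq r s -> frac_eq s t -> frac_eq r t.
Proof.
move=> [t1 [h1 h2]] [t2 [h3 h4]].
have [T [g1 g2]] := frac_le_join h2 h3.
by exists T; split; [exact: frac_le_trans h1 g1 | exact: frac_le_trans h4 g2].
Qed.

Lemma frac_le_eq M N (r s : frac C M N) : frac_le r s -> frac_eq r s.
Proof. by move=> h; exists s; split=> //; exact: frac_le_refl. Qed.

Lemma frac_comp_ex M N P (g : frac C N P) (f : frac C M N) :
  exists h, frac_comp g f h.
Proof.
have [I [e [m [ee mm eI]]]] := image_ex hA (fprj f ∘ finc g).
have hm : mono_modC C m.
  exact: (mono_modC_image hA hC (finc_modC g) (fprj_modC f).1 ee mm eI).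
have he : epi_modC C e.
  exact: (epi_modC_image hA hC (fprj_modC f) (finc_modC g).1 mm ee eI).
have [D [u [v [hu euv]]]] := mono_modC_pull hA hC (fmap f) hm.
have [Q [w [g' [hw ewg]]]] := epi_modC_push hA hC (fmap g) he.
have hi := mono_modC_comp hA hC (finc_modC f) hu.
have hp := epi_modC_comp hA hC hw (fprj_modC g).
by exists (Frac (g' ∘ v) hi hp), I, e, m, u, v, w, g'.
Qed.

Lemma epi_mono_fill (x y z w : A) (e : hom x y) (t : hom y z) (s : hom x w)
    (m : hom w z) : is_epi e -> is_mono m -> m ∘ s = t ∘ e ->
  exists c : hom y w, c ∘ e = s /\ m ∘ c = t.
Proof.
move=> ee mm eq; have [v [h kh]] := ab_epi_normal hA ee.
have sh : s ∘ h = 0.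
  by apply: (mono_eq0 hL mm); rewrite compA eq -compA kh.1 (compf0 hL).
have [c ce] := cokernel_desc kh sh.
by exists c; split=> //; apply: ee; rewrite -compA ce.
Qed.

Lemma frac_comp_ler M N P (g : frac C N P) (f f2 : frac C M N)
    (h h2 : frac C M P) : frac_le f f2 ->
  frac_comp g f h -> frac_comp g f2 h2 -> frac_eq h h2.
Proof.
move=> [a [b [ea eb ef]]].
move=> [I [e [m [u [v [w [g' [[ee mm em] [eu ew] ev eg' eh]]]]]]]].
move=> [I2 [e2 [m2 [u2 [v2 [w2 [g2 [[ee2 mm2 em2] [eu2 ew2] ev2 eg2 eh2]]]]]]]].
have [D [Q [i [p [x [y [x2 [y2 [hi hp [ei ep] [ei2 ep2]]]]]]]]]] :=
  common_stage h h2.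
exists (Frac (y ∘ fmap h ∘ x) hi hp); split; first by exists x, y.
exists x2, y2; split=> //=.
have eux : u ∘ x = a ∘ u2 ∘ x2.
  by apply: (finc_modC f).1; rewrite !compA -eu -ei ei2 eu2 ea.
have ewy : y ∘ w = y2 ∘ w2.
  by apply: (fprj_modC g).1; rewrite -!compA -ew -ep ep2 ew2.
have [c [ce mc]] : exists c : hom I I2, c ∘ e = e2 /\ m2 ∘ c = b ∘ m.
  by apply: epi_mono_fill => //; rewrite em2 eb -compA -em compA.
have evx : c ∘ v ∘ x = v2 ∘ x2.
  apply: mm2.
  by rewrite !compA mc ev2 ef -(compA b m) ev -!compA (compA a) -eux !compA.
have egy : y ∘ g' = y2 ∘ g2 ∘ c.
  by apply: ee; rewrite -!compA ce eg' eg2 !compA ewy.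
by rewrite eh eh2 !compA egy -!compA -evx !compA.
Qed.

Lemma frac_comp_lel M N P (g g2 : frac C N P) (f : frac C M N)
    (h h2 : frac C M P) : frac_le g g2 ->
  frac_comp g f h -> frac_comp g2 f h2 -> frac_eq h h2.
Proof.
move=> [a [b [ea eb eg]]].
move=> [I [e [m [u [v [w [g' [[ee mm em] [eu ew] ev eg' eh]]]]]]]].
move=> [I2 [e2 [m2 [u2 [v2 [w2 [g3 [[ee2 mm2 em2] [eu2 ew2] ev2 eg2 eh2]]]]]]]].
have [D [Q [i [p [x [y [x2 [y2 [hi hp [ei ep] [ei2 ep2]]]]]]]]]] :=
  common_stage h h2.
exists (Frac (y ∘ fmap h ∘ x) hi hp); split; first by exists x, y.
exists x2, y2; split=> //=.
have eux : u ∘ x = u2 ∘ x2.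
  by apply: (finc_modC f).1; rewrite !compA -eu -ei ei2 eu2.
have ewy : y ∘ w = y2 ∘ w2 ∘ b.
  by apply: (fprj_modC g).1; rewrite -!compA -eb -ew -ep ep2 ew2.
have [c [ce mc]] : exists c : hom I2 I, c ∘ e2 = e ∘ a /\ m ∘ c = m2.
  by apply: epi_mono_fill => //; rewrite em2 ea !compA em.
have evx : v ∘ x = c ∘ v2 ∘ x2.
  by apply: mm; rewrite !compA mc ev ev2 -!compA eux.
have egy : y ∘ g' ∘ c = y2 ∘ g3.
  apply: ee2; rewrite -!compA ce eg2 eg (compA g') eg' !compA ewy.
  by rewrite -!compA.
by rewrite eh eh2 -!compA evx !compA egy.
Qed.

Lemma frac_comp_eq M N P (g g2 : frac C N P) (f f2 : frac C M N)
    (h h2 : frac C M P) : frac_eq g g2 -> frac_eq f f2 ->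
  frac_comp g f h -> frac_comp g2 f2 h2 -> frac_eq h h2.
Proof.
move=> [g3 [lg lg2]] [f3 [lf lf2]] hh hh2.
have [h3 hh3] := frac_comp_ex g f3; have [h4 hh4] := frac_comp_ex g f2.
have [h5 hh5] := frac_comp_ex g3 f2.
apply: frac_eq_trans (frac_comp_ler lf hh hh3) _.
apply: frac_eq_trans (frac_eq_sym (frac_comp_ler lf2 hh4 hh3)) _.
apply: frac_eq_trans (frac_comp_lel lg hh4 hh5) _.
exact: frac_eq_sym (frac_comp_lel lg2 hh2 hh5).
Qed.

Lemma frac_sum_ex M N (r s : frac C M N) : exists t, frac_sum r s t.
Proof.
have [D [Q [i [p [u1 [w1 [u2 [w2 [hi hp e1 e2]]]]]]]]] := common_stage r s.
exists (Frac (w1 ∘ fmap r ∘ u1 + w2 ∘ fmap s ∘ u2) hi hp).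
by exists u1, w1, u2, w2.
Qed.

Lemma frac_sum_le M N (r r2 s s2 t t2 : frac C M N) :
  frac_le r r2 -> frac_le s s2 ->
  frac_sum r s t -> frac_sum r2 s2 t2 -> frac_eq t t2.
Proof.
move=> [a [b [ea eb er]]] [a' [b' [ea' eb' es]]].
move=> [u1 [w1 [u2 [w2 [[eu1 ew1] [eu2 ew2] et]]]]].
move=> [v1 [z1 [v2 [z2 [[ev1 ez1] [ev2 ez2] et2]]]]].
have [D [Q [i [p [x [y [x2 [y2 [hi hp [ei ep] [ei2 ep2]]]]]]]]]] :=
  common_stage t t2.
exists (Frac (y ∘ fmap t ∘ x) hi hp); split; first by exists x, y.
exists x2, y2; split=> //=.
have e1 : u1 ∘ x = a ∘ v1 ∘ x2.
  by apply: (finc_modC r).1; rewrite !compA -eu1 -ei ei2 ev1 ea.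
have e2 : u2 ∘ x = a' ∘ v2 ∘ x2.
  by apply: (finc_modC s).1; rewrite !compA -eu2 -ei ei2 ev2 ea'.
have f1 : y ∘ w1 = y2 ∘ z1 ∘ b.
  by apply: (fprj_modC r).1; rewrite -!compA -ew1 -ep ep2 ez1 eb.
have f2 : y ∘ w2 = y2 ∘ z2 ∘ b'.
  by apply: (fprj_modC s).1; rewrite -!compA -ew2 -ep ep2 ez2 eb'.
rewrite et et2 er es !(compfD hL, compDf hL) !compA f1 f2.
by rewrite -(compA _ u1) -(compA _ u2) e1 e2 !compA.
Qed.

Lemma frac_sum_eq M N (r r2 s s2 t t2 : frac C M N) :
  frac_eq r r2 -> frac_eq s s2 ->
  frac_sum r s t -> frac_sum r2 s2 t2 -> frac_eq t t2.
Proof.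
move=> [r3 [lr lr2]] [s3 [ls ls2]] h h2.
have [t3 h3] := frac_sum_ex r3 s3.
apply: frac_eq_trans (frac_sum_le lr ls h h3) _.
exact: frac_eq_sym (frac_sum_le lr2 ls2 h2 h3).
Qed.

Definition frac_scale a M N (r : frac C M N) : frac C M N :=
  Frac (a *: fmap r) (finc_modC r) (fprj_modC r).

Lemma frac_scale_eq a M N (r s : frac C M N) :
  frac_eq r s -> frac_eq (frac_scale a r) (frac_scale a s).
Proof.
have le t t' : frac_le t t' -> frac_le (frac_scale a t) (frac_scale a t').
  move=> [u [w [e1 e2 e3]]]; exists u, w; split=> //=.
  by rewrite e3 (compfZ hL) (compZf hL).
by move=> [t [h1 h2]]; exists (frac_scale a t); split; exact: le.
Qed.

(* The fraction M = M -> N = N/0 given by a morphism of A. *)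
Definition frac_of M N (f : hom M N) : frac C M N :=
  Frac f (mono_modC_id hA hC M) (epi_modC_id hA hC N).

End FractionTheory.

Section QuotientHom.
Variables (k : fieldType) (A : precat k) (C : A -> Prop).
Hypothesis hA : is_linear_abelian A.
Hypothesis hC : is_serre C.
Implicit Types M N P : A.

HB.instance Definition _ M N := gen_eqMixin (frac C M N).
HB.instance Definition _ M N := gen_choiceMixin (frac C M N).

Definition frac_eqb M N : rel (frac C M N) := fun r s => `[< frac_eq r s >].

Lemma frac_eqb_refl M N : reflexive (@frac_eqb M N).
Proof. by move=> r; apply/asboolP; exact: frac_eq_refl. Qed.

Lemma frac_eqb_sym M N : symmetric (@frac_eqb M N).
Proof.
by move=> r s; apply/asboolP/asboolP; exact: frac_eq_sym.
Qed.

Lemma frac_eqb_trans M N : transitive (@frac_eqb M N).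
Proof.
move=> s r t /asboolP h1 /asboolP h2; apply/asboolP.
exact: (frac_eq_trans hA hC h1 h2).
Qed.

Definition frac_equiv M N : equiv_rel (frac C M N) :=
  EquivRel (@frac_eqb M N) (@frac_eqb_refl M N) (@frac_eqb_sym M N)
    (@frac_eqb_trans M N).

(* Hom_(A/C)(M, N) *)
Definition qhom M N : Type := {eq_quot (frac_equiv M N)}.

HB.instance Definition _ M N := Choice.on (qhom M N).

(* The morphism Tf of A/C represented by a fraction f. *)
Definition qclass M N (r : frac C M N) : qhom M N :=
  \pi_{eq_quot (frac_equiv M N)} r.

Definition qrepr M N (F : qhom M N) : frac C M N :=
  repr (F : {eq_quot (frac_equiv M N)}).

Lemma qreprK M N (F : qhom M N) : qclass (qrepr F) = F.
Proof. exact: reprK. Qed.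

Lemma qclassP M N (r s : frac C M N) :
  qclass r = qclass s <-> frac_eq r s.
Proof.
split=> [e|h]; first by apply/asboolP; apply/(@eqmodP _ (frac_equiv M N)).
by apply/(@eqmodP _ (frac_equiv M N)); apply/asboolP.
Qed.

Lemma qrepr_eq M N (r : frac C M N) : frac_eq (qrepr (qclass r)) r.
Proof. by apply/qclassP; rewrite qreprK. Qed.

Definition qcomp M N P (G : qhom N P) (F : qhom M N) : qhom M P :=
  qclass (projT1 (cid (frac_comp_ex hA hC (qrepr G) (qrepr F)))).

(* [qcomp], like [qadd] and [qtens] below, does not depend on the chosen
   representatives. *)
Lemma qcompE M N P (g : frac C N P) (f : frac C M N) (h : frac C M P) :
  frac_comp g f h -> qcomp (qclass g) (qclass f) = qclass h.
Proof.
rewrite /qcomp; case: cid => h' /= hh' hh; apply/qclassP.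
exact: (frac_comp_eq hA hC (qrepr_eq g) (qrepr_eq f) hh' hh).
Qed.

Definition qadd M N (F G : qhom M N) : qhom M N :=
  qclass (projT1 (cid (frac_sum_ex hA hC (qrepr F) (qrepr G)))).

Lemma qaddE M N (r s t : frac C M N) :
  frac_sum r s t -> qadd (qclass r) (qclass s) = qclass t.
Proof.
rewrite /qadd; case: cid => t' /= ht' ht; apply/qclassP.
exact: (frac_sum_eq hA hC (qrepr_eq r) (qrepr_eq s) ht' ht).
Qed.

Definition qscale M N (a : k) (F : qhom M N) : qhom M N :=
  qclass (frac_scale a (qrepr F)).

Lemma qscaleE M N a (r : frac C M N) :
  qscale a (qclass r) = qclass (frac_scale a r).
Proof. by apply/qclassP; apply: (frac_scale_eq hA); exact: qrepr_eq. Qed.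

Definition qzero M N : qhom M N := qclass (frac_of hA hC 0).

Definition qopp M N (F : qhom M N) : qhom M N := qscale (-1) F.

Section Stage.
Variables (M N D Q : A) (i : hom D M) (p : hom N Q).
Hypotheses (hi : mono_modC C i) (hp : epi_modC C p).

Let st (f : hom D Q) : qhom M N := qclass (Frac f hi hp).

Lemma qadd_stage f g : qadd (st f) (st g) = st (f + g).
Proof.
apply: qaddE; exists (idm _), (idm _), (idm _), (idm _) => /=.
by rewrite !(cat_compf1 hA) !(cat_comp1f hA).
Qed.

Lemma qscale_stage a f : qscale a (st f) = st (a *: f).
Proof. exact: qscaleE. Qed.

Lemma qzero_stage : qzero M N = st 0.
Proof.
apply/qclassP; apply: (frac_le_eq hA); exists i, p; split=> /=.
- by rewrite (cat_comp1f hA).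
- by rewrite (cat_compf1 hA).
- by rewrite (compf0 hA) (comp0f hA).
Qed.

End Stage.

Lemma qhom_stage2 M N (F G : qhom M N) :
  exists (D Q : A) (i : hom D M) (p : hom N Q) (hi : mono_modC C i)
         (hp : epi_modC C p) (f g : hom D Q),
    F = qclass (Frac f hi hp) /\ G = qclass (Frac g hi hp).
Proof.
have [D [Q [i [p [u1 [w1 [u2 [w2 [hi hp e1 e2]]]]]]]]] :=
  common_stage hA hC (qrepr F) (qrepr G).
exists D, Q, i, p, hi, hp.
exists (w1 ∘ fmap (qrepr F) ∘ u1), (w2 ∘ fmap (qrepr G) ∘ u2).
rewrite -{1}(qreprK F) -{1}(qreprK G); split; apply/qclassP.
  by apply: (frac_le_eq hA); exists u1, w1; case: e1.
by apply: (frac_le_eq hA); exists u2, w2; case: e2.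
Qed.

Lemma qhom_stage3 M N (F G H : qhom M N) :
  exists (D Q : A) (i : hom D M) (p : hom N Q) (hi : mono_modC C i)
         (hp : epi_modC C p) (f g h : hom D Q),
    [/\ F = qclass (Frac f hi hp), G = qclass (Frac g hi hp)
      & H = qclass (Frac h hi hp)].
Proof.
have [D0 [Q0 [i0 [p0 [hi0 [hp0 [f0 [g0 [eF eG]]]]]]]]] := qhom_stage2 F G.
have [D [Q [i [p [u1 [w1 [u2 [w2 [hi hp e1 e2]]]]]]]]] :=
  common_stage hA hC (Frac f0 hi0 hp0) (qrepr H).
exists D, Q, i, p, hi, hp.
exists (w1 ∘ f0 ∘ u1), (w1 ∘ g0 ∘ u1), (w2 ∘ fmap (qrepr H) ∘ u2).
rewrite eF eG -{1}(qreprK H); split; apply/qclassP; apply: (frac_le_eq hA).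
- by exists u1, w1; case: e1.
- by exists u1, w1; case: e1.
- by exists u2, w2; case: e2.
Qed.

Lemma qaddA M N : associative (@qadd M N).
Proof.
move=> F G H.
have [D [Q [i [p [hi [hp [f [g [h [-> -> ->]]]]]]]]]] := qhom_stage3 F G H.
by rewrite !qadd_stage addrA.
Qed.

Lemma qaddC M N : commutative (@qadd M N).
Proof.
move=> F G.
have [D [Q [i [p [hi [hp [f [g [-> ->]]]]]]]]] := qhom_stage2 F G.
by rewrite !qadd_stage addrC.
Qed.

Lemma qadd0 M N : left_id (qzero M N) (@qadd M N).
Proof.
move=> F; have [D [Q [i [p [hi [hp [f [_ [-> _]]]]]]]]] := qhom_stage2 F F.
by rewrite (qzero_stage hi hp) qadd_stage add0r.
Qed.

Lemma qaddN M N : left_inverse (qzero M N) (@qopp M N) (@qadd M N).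
Proof.
move=> F; have [D [Q [i [p [hi [hp [f [_ [-> _]]]]]]]]] := qhom_stage2 F F.
by rewrite /qopp qscale_stage qadd_stage (qzero_stage hi hp) scaleN1r addNr.
Qed.

HB.instance Definition _ M N := GRing.isZmodule.Build (qhom M N)
  (@qaddA M N) (@qaddC M N) (@qadd0 M N) (@qaddN M N).

Lemma qscaleA M N a b (F : qhom M N) :
  qscale a (qscale b F) = qscale (a * b) F.
Proof.
have [D [Q [i [p [hi [hp [f [_ [-> _]]]]]]]]] := qhom_stage2 F F.
by rewrite !qscale_stage scalerA.
Qed.

Lemma qscale1 M N : left_id 1 (@qscale M N).
Proof.
move=> F; have [D [Q [i [p [hi [hp [f [_ [-> _]]]]]]]]] := qhom_stage2 F F.
by rewrite !qscale_stage scale1r.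
Qed.

Lemma qscaleDr M N : right_distributive (@qscale M N) +%R.
Proof.
move=> a F G.
have [D [Q [i [p [hi [hp [f [g [-> ->]]]]]]]]] := qhom_stage2 F G.
change (qscale a (qadd (qclass (Frac f hi hp)) (qclass (Frac g hi hp))) =
  qadd (qscale a (qclass (Frac f hi hp))) (qscale a (qclass (Frac g hi hp)))).
by rewrite !qadd_stage !qscale_stage qadd_stage scalerDr.
Qed.

Lemma qscaleDl M N (F : qhom M N) :
  {morph (@qscale M N)^~ F : a b / a + b >-> a + b}.
Proof.
move=> a b.
have [D [Q [i [p [hi [hp [f [_ [-> _]]]]]]]]] := qhom_stage2 F F.
change (qscale (a + b) (qclass (Frac f hi hp)) =
  qadd (qscale a (qclass (Frac f hi hp))) (qscale b (qclass (Frac f hi hp)))).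
by rewrite !qscale_stage qadd_stage scalerDl.
Qed.

HB.instance Definition _ M N := GRing.Zmodule_isLmodule.Build k (qhom M N)
  (@qscaleA M N) (@qscale1 M N) (@qscaleDr M N) (@qscaleDl M N).

(* The category A/C. *)
Definition serre_quotient : precat k := @Precat k A
  (fun M N => qhom M N : lmodType k)
  (fun M => qclass (frac_of hA hC (idm M)))
  (fun M N P G F => qcomp G F).

(* The canonical functor T : A -> A/C on morphisms. *)
Definition qfunctor M N (f : hom M N) : @hom k serre_quotient M N :=
  qclass (frac_of hA hC f).

End QuotientHom.

Section TensorFractions.
Variables (k : fieldType) (A : premonoidal k) (C : A -> Prop).
Hypothesis hA : is_multiring A.
Hypothesis hC : is_serre_tensor_ideal C.
Implicit Types M N X Y : A.

Let hL : is_linear_cat A := hA.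
Let compA := cat_compA hL.

Lemma mono_modC_tens M' M X' X (i : hom M' M) (j : hom X' X) :
  mono_modC C i -> mono_modC C j -> mono_modC C (i ⊠ j).
Proof.
move=> [mi [p [c [kc Cp]]]] [mj [q [d [kd Cq]]]].
have -> : i ⊠ j = (i ⊠ idm X) ∘ (idm M' ⊠ j).
  rewrite -(tens_comp (mr_monoidal hA)).
  by rewrite (cat_compf1 hL) (cat_comp1f hL).
have sec : short_exact i c by split=> //; exact: (mono_kernel hA).
have sed : short_exact j d by split=> //; exact: (mono_kernel hA).
have [[kic cic] _] := mr_biexact hA X sec.
have [_ [kjd cjd]] := mr_biexact hA M' sed.
apply: (mono_modC_comp hA hC).
  split; first exact: (kernel_mono hL kic).
  by exists (p ⊗ X), (c ⊠ idm X); split=> //; case: (ideal_tens hC X Cp).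
split; first exact: (kernel_mono hL kjd).
by exists (M' ⊗ q), (idm M' ⊠ d); split=> //; case: (ideal_tens hC M' Cq).
Qed.

Lemma epi_kernel_short_exact (x y w : A) (p : hom x y) (j : hom w x) :
  is_epi p -> is_kernel p j -> short_exact j p.
Proof.
move=> ep kj; split=> //.
exact: (mono_kernel (opcat_abelian hA) ep kj).
Qed.

Lemma epi_modC_tens N N'' Y Y'' (p : hom N N'') (q : hom Y Y'') :
  epi_modC C p -> epi_modC C q -> epi_modC C (p ⊠ q).
Proof.
move=> [ep [x [c [kc Cx]]]] [eq [y [d [kd Cy]]]].
have -> : p ⊠ q = (p ⊠ idm Y'') ∘ (idm N ⊠ q).
  rewrite -(tens_comp (mr_monoidal hA)).
  by rewrite (cat_compf1 hL) (cat_comp1f hL).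
have sec := epi_kernel_short_exact ep kc.
have sed := epi_kernel_short_exact eq kd.
have [[kic cic] _] := mr_biexact hA Y'' sec.
have [_ [kjd cjd]] := mr_biexact hA N sed.
apply: (epi_modC_comp hA hC).
  split; first exact: (cokernel_epi hL cic).
  by exists (x ⊗ Y''), (c ⊠ idm Y''); split=> //; case: (ideal_tens hC Y'' Cx).
split; first exact: (cokernel_epi hL cjd).
by exists (N ⊗ y), (idm N ⊠ d); split=> //; case: (ideal_tens hC N Cy).
Qed.

(* f ⊗ g : M' ⊗ X' -> (N/N') ⊗ (Y/Y'). *)
Definition frac_tens M N X Y (f : frac C M N) (g : frac C X Y) :
    frac C (M ⊗ X) (N ⊗ Y) :=
  Frac (fmap f ⊠ fmap g) (mono_modC_tens (finc_modC f) (finc_modC g))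
    (epi_modC_tens (fprj_modC f) (fprj_modC g)).

Lemma frac_tens_eq M N X Y (f f2 : frac C M N) (g g2 : frac C X Y) :
  frac_eq f f2 -> frac_eq g g2 -> frac_eq (frac_tens f g) (frac_tens f2 g2).
Proof.
have le (r r' : frac C M N) (s s' : frac C X Y) : frac_le r r' ->
    frac_le s s' -> frac_le (frac_tens r s) (frac_tens r' s').
  move=> [u [w [e1 e2 e3]]] [u' [w' [e1' e2' e3']]].
  exists (u ⊠ u'), (w ⊠ w'); split=> /=.
  - by rewrite e1 e1' (tens_comp (mr_monoidal hA)).
  - by rewrite e2 e2' (tens_comp (mr_monoidal hA)).
  - by rewrite e3 e3' !(tens_comp (mr_monoidal hA)).
move=> [f3 [hf hf2]] [g3 [hg hg2]].
by exists (frac_tens f3 g3); split; exact: le.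
Qed.

Local Notation AC := (serre_quotient hA hC).

Definition qtens M N X Y (F : @hom k AC M N) (G : @hom k AC X Y) :
    @hom k AC (M ⊗ X) (N ⊗ Y) :=
  qclass hA hC (frac_tens (qrepr F) (qrepr G)).

Lemma qtensE M N X Y (f : frac C M N) (g : frac C X Y) :
  qtens (qclass hA hC f) (qclass hA hC g) = qclass hA hC (frac_tens f g).
Proof. by apply/qclassP; apply: frac_tens_eq; exact: qrepr_eq. Qed.

(* A/C with the monoidal structure induced from A. *)
Definition serre_quotient_mon : premonoidal k := @Premonoidal k AC
  unit_ob
  (fun M X => M ⊗ X)
  (fun M N X Y F G => qtens F G)
  (fun x y z => qfunctor hA hC (assoc x y z))
  (fun x => qfunctor hA hC (lunit x))
  (fun x => qfunctor hA hC (runit x)).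

End TensorFractions.

(* Main.v *)
From HB Require Import structures.
From mathcomp Require Import all_boot all_algebra boolp.
Require Import Defs.

(** The canonical functor T : A -> A/C is a localization admitting both a right
    and a left calculus of fractions: every F : x -> y of A/C becomes a morphism
    of A after composition with an isomorphism T s on either side, and T f = 0
    forces f s = 0 = s' f for suitable s, s' inverted by T.  Together with the
    linearity of T these axioms ([is_localization]) imply that T is exact and
    A/C abelian: a kernel of F is computed from a kernel of a morphism of A, a
    monomorphism of A/C is T m composed with an isomorphism, m being the image
    inclusion of a numerator, and a short exact sequence of A/C is isomorphic to
    the image of one of A ([loc_short_exact_lift]).  The axioms are self-dual,
    so the statements on cokernels and epimorphisms are those on kernels and
    monomorphisms in the opposite categories.

    To obtain the axioms from Gabriel's fractions M' -> N/N', the fraction given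
    by i : M' -> M, p : N -> N/N' and f is written as T(p)^-1 T(f) T(i)^-1
    ([qclass_factor]).  Composing a fraction with a morphism T u has an easy
    formula, so H (G F) = (H G) F and the linearity of G |-> G F hold for F = T u;
    they pass to inverses and composites, hence to every F ([qhom_ind]).  The
    linearity in the other argument is obtained in the same way.

    Local finiteness comes from the finite length of objects.  Chains of proper
    subobjects, and of proper quotients, of a given object have bounded length,
    so there are a least M' with M/M' in C and a largest N' in C; the direct
    system defining Hom(M, N) then has a last term Hom_A(M', N/N'), which is
    finite dimensional ([qhom_terminal_stage]).  The image in A/C of a simple
    object is simple or zero, so that T carries a composition series to one,
    after deletion of the steps that become trivial.

    As for the tensor product, tensoring all the data witnessing two composites
    of fractions gives data for the composite of the tensor products
    ([frac_comp_tens]), so the tensor product is a functor; the constraints are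
    natural because they are so on numerators, inclusions and projections
    separately; the coherence axioms are images under T of those of A; and
    biexactness holds because every short exact sequence of A/C comes from A. *)

Set Implicit Arguments.
Unset Strict Implicit.
Unset Printing Implicit Defensive.

Import GRing.Theory.
Local Open Scope ring_scope.
Local Open Scope cat_scope.

(** * Isomorphisms, kernels and cokernels in linear categories *)

Section IsoTransport.
Variables (k : fieldType) (A : precat k).
Hypothesis hA : is_linear_cat A.
Implicit Types x y z w : A.

Let compA := cat_compA hA.

Lemma iso_mono x y (f : hom x y) : is_iso f -> is_mono f.
Proof.
move=> [g [gf _]] w a b e.
by rewrite -(cat_comp1f hA a) -(cat_comp1f hA b) -gf -!compA e.
Qed.

Lemma iso_id x : is_iso (idm x).
Proof. by exists (idm x); rewrite (cat_comp1f hA). Qed.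

Lemma iso_comp x y z (g : hom y z) (f : hom x y) :
  is_iso g -> is_iso f -> is_iso (g ∘ f).
Proof.
move=> [g' [g'g gg']] [f' [f'f ff']]; exists (f' ∘ g'); split.
  by rewrite -compA (compA g') g'g (cat_comp1f hA).
by rewrite -compA (compA f) ff' (cat_comp1f hA).
Qed.

Lemma kernel_precomp_iso x' x y w (f : hom x y) (s : hom x' x) (j : hom w x') :
  is_iso s -> is_kernel (f ∘ s) j -> is_kernel f (s ∘ j).
Proof.
move=> iso_s kj; have [s' [_ ss']] := iso_s; apply: kernelP => //.
- exact: (mono_comp hA (iso_mono iso_s) (kernel_mono hA kj)).
- by rewrite compA kj.1.
- move=> v t ft.
  have [|r er] := kernel_lift (t := s' ∘ t) kj.
    by rewrite -compA (compA s) ss' (cat_comp1f hA).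
  by exists r; rewrite -compA er compA ss' (cat_comp1f hA).
Qed.

Lemma kernel_mono_postcomp x y y' w (f : hom x y) (m : hom y y') (j : hom w x) :
  is_mono m -> is_kernel f j -> is_kernel (m ∘ f) j.
Proof.
move=> mm kj; apply: kernelP => //; first exact: (kernel_mono hA kj).
  by rewrite -compA kj.1 (compf0 hA).
move=> v t; rewrite -compA => /(mono_eq0 hA mm); exact: (kernel_lift kj).
Qed.

Lemma kernel_sub_iso x y w w' (f : hom x y) (j : hom w x) (s : hom w' w) :
  is_iso s -> is_kernel f j -> is_kernel f (j ∘ s).
Proof.
move=> iso_s kj; have [s' [_ ss']] := iso_s; apply: kernelP => //.
- exact: (mono_comp hA (kernel_mono hA kj) (iso_mono iso_s)).
- by rewrite compA kj.1 (comp0f hA).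
- move=> v t /(kernel_lift kj) [r <-]; exists (s' ∘ r).
  by rewrite -compA (compA s) ss' (cat_comp1f hA).
Qed.

Lemma kernel_unique x y w w' (f : hom x y) (j : hom w x) (j' : hom w' x) :
  is_kernel f j -> is_kernel f j' ->
  exists s : hom w' w, is_iso s /\ j ∘ s = j'.
Proof.
move=> kj kj'.
have [s es] := kernel_lift kj kj'.1; have [s' es'] := kernel_lift kj' kj.1.
exists s; split=> //; exists s'; split.
  by apply: (kernel_mono hA kj'); rewrite compA es' es (cat_compf1 hA).
by apply: (kernel_mono hA kj); rewrite compA es es' (cat_compf1 hA).
Qed.

Lemma kernel_of_mono_eq0 x y w (f : hom x y) (j : hom w x) :
  is_mono f -> is_kernel f j -> j = 0.
Proof. by move=> mf [fj _]; exact: (mono_eq0 hA mf fj). Qed.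

Lemma kernel0_iso x y w (j : hom w x) : is_kernel (0 : hom x y) j -> is_iso j.
Proof.
move=> kj; have [|s es] := kernel_lift (t := idm x) kj.
  by rewrite (comp0f hA).
exists s; split=> //; apply: (kernel_mono hA kj).
by rewrite compA es (cat_comp1f hA) (cat_compf1 hA).
Qed.

Lemma kernel_eq0_mono x y w (f : hom x y) (j : hom w x) :
  is_kernel f j -> j = 0 -> is_mono f.
Proof.
move=> kj j0; apply: (mono0P hA) => v t ft.
by have [s <-] := kernel_lift kj ft; rewrite j0 (comp0f hA).
Qed.

Lemma zero_obP x : is_zero_ob x <-> idm x = 0.
Proof.
split=> [hx|e y]; first by case: (hx x) => h _; exact: h.
split=> f; first by rewrite -(cat_comp1f hA f) e (comp0f hA).
by rewrite -(cat_compf1 hA f) e (compf0 hA).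
Qed.

Lemma mono_zero_ob x y (f : hom x y) :
  is_mono f -> is_zero_ob y -> is_zero_ob x.
Proof.
move=> mf hy; apply/zero_obP; apply: mf.
by rewrite (compf0 hA) ((hy x).1 f) (comp0f hA).
Qed.

End IsoTransport.

Section IsoTransportDual.
Variables (k : fieldType) (A : precat k).
Hypothesis hA : is_linear_cat A.
Implicit Types x y z w : A.

Let hAop := opcat_linear hA.

Lemma opcat_iso x y (f : hom x y) : is_iso f <-> @is_iso k (opcat A) y x f.
Proof. by split=> -[g [h1 h2]]; exists g. Qed.

Lemma opcat_zero_ob x : is_zero_ob x <-> @is_zero_ob k (opcat A) x.
Proof. by split=> h y; case: (h y). Qed.

Lemma iso_epi x y (f : hom x y) : is_iso f -> is_epi f.
Proof. by move/opcat_iso; exact: (iso_mono hAop). Qed.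

Lemma cokernel_quot_iso x y w w' (f : hom x y) (c : hom y w) (s : hom w w') :
  is_iso s -> is_cokernel f c -> is_cokernel f (s ∘ c).
Proof. by move/opcat_iso; exact: (kernel_sub_iso hAop). Qed.

Lemma cokernel_epi_precomp x' x y w (f : hom x y) (e : hom x' x) (c : hom y w) :
  is_epi e -> is_cokernel f c -> is_cokernel (f ∘ e) c.
Proof. exact: (kernel_mono_postcomp hAop). Qed.

Lemma cokernel_unique x y w w' (f : hom x y) (c : hom y w) (c' : hom y w') :
  is_cokernel f c -> is_cokernel f c' ->
  exists s : hom w w', is_iso s /\ s ∘ c = c'.
Proof.
move=> kc kc'; have [s [iso_s es]] := kernel_unique hAop kc kc'.
by exists s; split=> //; apply/opcat_iso.
Qed.

Lemma cokernel0_iso x y w (c : hom y w) :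
  is_cokernel (0 : hom x y) c -> is_iso c.
Proof. by move=> kc; apply/opcat_iso; exact: (kernel0_iso hAop kc). Qed.

Lemma short_exact_iso x' x y z z' (i : hom x y) (p : hom y z)
    (s : hom x' x) (t : hom z z') :
  is_iso s -> is_iso t -> short_exact i p -> short_exact (i ∘ s) (t ∘ p).
Proof.
move=> hs ht [ki kp]; split.
  apply: (kernel_sub_iso hA hs).
  exact: (kernel_mono_postcomp hA (iso_mono hA ht) ki).
apply: (cokernel_quot_iso ht); exact: (cokernel_epi_precomp (iso_epi hs) kp).
Qed.

Lemma finite_length_iso x y (s : hom x y) :
  is_iso s -> finite_length x -> finite_length y.
Proof.
move=> hs fx; have [t [ts st]] := hs.
have ht : is_iso t by exists s.
case: fx s t hs ht ts st => [{}x hx|w {}x u i p ip su fw] s t hs ht ts st.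
  by apply: FiniteLength0; exact: (mono_zero_ob hA (iso_mono hA ht) hx).
apply: (FiniteLengthS (i := s ∘ i) (p := p ∘ t)) su fw.
have [ki cp] := ip; split.
  apply: (kernel_precomp_iso hA hs).
  by rewrite -(cat_compA hA) ts (cat_compf1 hA).
apply: (kernel_precomp_iso (A := opcat A) hAop (s := t)).
  by apply/opcat_iso.
by rewrite /= (cat_compA hA) ts (cat_comp1f hA).
Qed.

End IsoTransportDual.

(** * Images and pullbacks in abelian categories *)

Section AbelianMore.
Variables (k : fieldType) (A : precat k).
Hypothesis hA : is_linear_abelian A.
Implicit Types x y z w : A.

Let hL : is_linear_cat A := hA.
Let compA := cat_compA hL.

Lemma epi_cokernel x y w (f : hom x y) (j : hom w x) :
  is_epi f -> is_kernel f j -> is_cokernel j f.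
Proof. exact: (mono_kernel (opcat_abelian hA)). Qed.

Lemma mono_epi_iso x y (f : hom x y) : is_mono f -> is_epi f -> is_iso f.
Proof.
move=> mf ef; have [w [g kg]] := ab_mono_normal hA mf.
have g0 : g = 0 by exact: (epi_eq0 hL ef kg.1).
by rewrite g0 in kg; exact: (kernel0_iso hL kg).
Qed.

Lemma mono_short_exact x y (i : hom x y) : is_mono i ->
  exists z (c : hom y z), short_exact i c.
Proof.
move=> mi; have [z [c kc]] := ab_cokernel hA i.
by exists z, c; split=> //; exact: (mono_kernel hA mi kc).
Qed.

Lemma image_short_exact x y (f : hom x y) :
  exists w I (j : hom w x) (e : hom x I) (m : hom I y),
  [/\ is_kernel f j, short_exact j e, is_mono m & m ∘ e = f].
Proof.
have [I [e [m [ee mm me]]]] := image_ex hA f.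
have [w [j kj]] := ab_kernel hA e.
exists w, I, j, e, m; split=> //.
  by rewrite -me; exact: (kernel_mono_postcomp hL mm kj).
by split=> //; exact: (epi_cokernel ee kj).
Qed.

Lemma simple_opcat x : is_simple x -> @is_simple k (opcat A) x.
Proof.
move=> [nz sx]; split; first by move/opcat_zero_ob.
move=> y p ep.
have [w [j kj]] := ab_kernel hA (p : @hom k A x y).
have kp := epi_cokernel ep kj.
case: (sx _ j (kernel_mono hL kj)) => [hw|iso_j].
  right; apply/opcat_iso.
  have j0 : j = 0 by rewrite ((hw x).2 j).
  by rewrite j0 in kp; exact: (cokernel0_iso hL kp).
left; apply/opcat_zero_ob/(zero_obP hL).
apply: (ep : @is_epi k A x y p).
rewrite (comp0f hL) (cat_comp1f hL).
exact: (epi_eq0 hL (iso_epi hL iso_j) kj.1).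
Qed.

(** The fibre product of f and p is the kernel of f p1 - p p2 on the biproduct
    of x and y. The last clause expresses that s and b are jointly monic. *)
Lemma epi_pull x y z (f : hom x z) (p : hom y z) : is_epi p ->
  exists w (s : hom w x) (b : hom w y), [/\ is_epi s, p ∘ b = f ∘ s &
    forall v (t : hom v w), s ∘ t = 0 -> b ∘ t = 0 -> t = 0].
Proof.
move=> ep; have [d [i1 [i2 [p1 [p2 [h11 h22 h12 h21 hd]]]]]] :=
  ab_biproduct hA x y.
pose g := f ∘ p1 - p ∘ p2.
have gi2 : g ∘ i2 = - p.
  rewrite /g (compDf hL) (compNf hL) -!compA h12 h22 (compf0 hL).
  by rewrite (cat_compf1 hL) add0r.
have eg : is_epi g.
  apply: (epi_compl hL (f := i2)); rewrite gi2; apply: (epi0P hL) => v t.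
  by rewrite (compfN hL) => /eqP; rewrite oppr_eq0 => /eqP /(epi_eq0 hL ep).
have [w [l kl]] := ab_kernel hA g.
exists w, (p1 ∘ l), (p2 ∘ l); split.
- apply: (epi0P hL) => v t; rewrite compA => tl.
  have [t' et'] := cokernel_desc (epi_cokernel eg kl) tl.
  have t'0 : t' = 0.
    apply: (epi_eq0 hL ep); apply/eqP; rewrite -oppr_eq0 -(compfN hL) -gi2.
    by rewrite compA et' -compA h12 (compf0 hL).
  rewrite -(cat_compf1 hL t) -h11 compA -et' t'0.
  by rewrite !(comp0f hL).
- have := kl.1; rewrite /g (compDf hL) (compNf hL) !compA => /eqP.
  by rewrite subr_eq0 => /eqP.
- move=> v t e1 e2; apply: (kernel_mono hL kl); rewrite (compf0 hL).
  rewrite -(cat_comp1f hL l) -hd !(compDf hL) -!compA.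
  by rewrite (compA p1) (compA p2) e1 e2 !(compf0 hL) addr0.
Qed.

End AbelianMore.

(** * Bounded chains of subobjects *)

Section ChainLength.
Variable k : fieldType.

(** A bound on the number of steps of a chain of proper subobjects, unlike a
    composition series, is visibly inherited by subobjects and is what a
    descending search for a least subobject consumes; quotients are treated by
    the same predicate in [opcat A]. *)
Fixpoint chain_bound (A : precat k) (n : nat) (x : A) : Prop :=
  if n is n'.+1 then
    forall y (i : hom y x), is_mono i -> is_iso i \/ chain_bound n' y
  else is_zero_ob x.

Lemma chain_bound_mono (A : precat k) n (x y : A) (i : hom y x) :
  is_linear_cat A -> is_mono i -> chain_bound n x -> chain_bound n y.
Proof.
move=> hL; elim: n x y i => [|n IH] x y i mi.
  exact: (mono_zero_ob hL mi).
move=> bx w j mj.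
case: (bx _ _ (mono_comp hL mi mj)) => [[g [g1 g2]]|]; last by right.
left; exists (g ∘ i); split; first by rewrite -(cat_compA hL).
by apply: mi; rewrite !(cat_compA hL) g2 (cat_comp1f hL) (cat_compf1 hL).
Qed.

(** A proper subobject of y meets x in a proper subobject or has a proper image
    in z, so each step of a chain in y uses up one step in x or one in z.  The
    statement is symmetric in x and z, so it serves both for series built up
    by simple quotients and, in the opposite category, for series built up by
    simple subobjects. *)
Lemma chain_bound_ext (A : precat k) n m (x y z : A) (i : hom x y)
    (p : hom y z) : is_linear_abelian A -> short_exact i p ->
  chain_bound n x -> chain_bound m z -> chain_bound (n + m) y.
Proof.
move=> hA; have hL : is_linear_cat A := hA.
have [N] := ubnP (n + m); elim: N n m x y z i p => // N IH n m x y z i p.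
move=> nmN [ki kp] bx bz.
(* d cuts out v in x and has image q in z; if both are everything then d is an
   epimorphism. *)
have key w (d : hom w y) : is_mono d -> is_iso d \/
    exists x' z' (j : hom x' w) (e : hom w z') (v : hom x' x) (q : hom z' z),
      [/\ short_exact j e, is_mono v, is_mono q & ~ (is_iso v /\ is_iso q)].
  move=> md.
  have [x' [z' [j [e [q [kj sje mq qe]]]]]] := image_short_exact hA (p ∘ d).
  have [v ev] : exists v : hom x' x, i ∘ v = d ∘ j.
    by apply: (kernel_lift ki); rewrite (cat_compA hL) kj.1.
  have mv : is_mono v.
    apply: (mono_compr hL (g := i)); rewrite ev.
    exact: (mono_comp hL md (kernel_mono hL kj)).
  have [[iv iq]|nvq] := pselect (is_iso v /\ is_iso q); last first.
    by right; exists x', z', j, e, v, q.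
  left; apply: (mono_epi_iso hA md); apply: (epi0P hL) => u t td.
  have ti : t ∘ i = 0.
    apply: (epi_eq0 hL (iso_epi hL iv)).
    by rewrite -(cat_compA hL) ev (cat_compA hL) td (comp0f hL).
  have [t' et'] := cokernel_desc kp ti.
  rewrite -et' (epi_eq0 hL (f := p ∘ d) (t := t')) ?(comp0f hL) //.
    rewrite -qe; apply: (epi_comp hL); first exact: (iso_epi hL iq).
    exact: (cokernel_epi hL sje.2).
  by rewrite (cat_compA hL) et'.
have zz (u v : A) (t : hom u v) : is_mono t -> is_zero_ob v -> is_iso t.
  move=> mt hv; apply: (mono_epi_iso hA mt); apply: (epi0P hL) => c s _.
  by rewrite ((hv c).2 s).
case: n => [|n] in nmN bx *; case: m => [|m] in nmN bz *.
- have i0 : i = 0 by rewrite ((bx y).2 i).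
  rewrite i0 in kp; rewrite /=.
  exact: (mono_zero_ob hL (iso_mono hL (cokernel0_iso hL kp)) bz).
- rewrite addnS => w d md; case: (key w d md) => [|]; first by left.
  move=> [x' [z' [j [e [v [q [se mv mq nvq]]]]]]]; right.
  case: (bz _ _ mq) => [iq|bq]; first by case: nvq; split=> //; exact: zz.
  apply: (IH 0 m _ _ _ j e) => //.
  exact: (mono_zero_ob hL mv bx).
- rewrite addSn => w d md; case: (key w d md) => [|]; first by left.
  move=> [x' [z' [j [e [v [q [se mv mq nvq]]]]]]]; right.
  case: (bx _ _ mv) => [iv|bv]; first by case: nvq; split=> //; exact: zz.
  apply: (IH n 0 _ _ _ j e) => //.
  exact: (mono_zero_ob hL mq bz).
- rewrite addSn => w d md; case: (key w d md) => [|]; first by left.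
  move=> [x' [z' [j [e [v [q [se mv mq nvq]]]]]]]; right.
  case: (bx _ _ mv) => [iv|bv].
    case: (bz _ _ mq) => [iq|bq]; first by case: nvq.
    change (chain_bound (n + m.+1) w); rewrite -addSnnS.
    apply: (IH n.+1 m _ _ _ j e) => //; first by rewrite addSnnS.
    exact: (chain_bound_mono hL mv bx).
  apply: (IH n m.+1 _ _ _ j e) => //.
  exact: (chain_bound_mono hL mq bz).
Qed.

Lemma chain_bound_simple (A : precat k) (x : A) :
  is_simple x -> chain_bound 1 x.
Proof. by move=> [_ sx] y i /sx [|]; [right | left]. Qed.

Lemma finite_length_chain_bound (A : precat k) (x : A) : is_linear_abelian A ->
  finite_length x -> exists n, chain_bound n x.
Proof.
move=> hA; elim=> [z hz|y {}x s i p sip ss _ [n bn]]; first by exists 0.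
by exists (n + 1)%N; apply: (chain_bound_ext hA sip bn (chain_bound_simple ss)).
Qed.

Lemma finite_length_cochain_bound (A : precat k) (x : A) :
  is_linear_abelian A -> finite_length x ->
  exists n, @chain_bound (opcat A) n x.
Proof.
move=> hA; elim=> [z hz|y {}x s i p [ki kp] ss _ [n bn]].
  by exists 0; apply/opcat_zero_ob.
exists (1 + n)%N.
apply: (chain_bound_ext (i := p : @hom k (opcat A) s x) (p := i)
  (opcat_abelian hA) _ _ bn); first by split.
exact: (chain_bound_simple (simple_opcat hA ss)).
Qed.

End ChainLength.

(** * Localizations of abelian categories *)

Section Localization.
Variable k : fieldType.

(** Both calculi of fractions for a linear functor.  Referring to the morphisms
    that [T] inverts, rather than a multiplicative class such as the morphisms with
    kernel and cokernel in C, keeps the axioms self-dual and free of C. *)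
Record is_localization (A Q : precat k) (T0 : A -> Q)
    (T : forall x y, hom x y -> hom (T0 x) (T0 y)) : Prop := IsLocalization {
  loc_ob : forall X : Q, exists x, T0 x = X;
  loc_id : forall x, T _ _ (idm x) = idm (T0 x);
  loc_comp : forall (x y z : A) (g : hom y z) (f : hom x y),
    T _ _ (g ∘ f) = T _ _ g ∘ T _ _ f;
  loc_linear : forall x y : A, linear (T x y);
  loc_roof : forall (x y : A) (F : hom (T0 x) (T0 y)),
    exists w (s : hom w x) (b : hom w y),
      is_iso (T _ _ s) /\ F ∘ T _ _ s = T _ _ b;
  loc_coroof : forall (x y : A) (F : hom (T0 x) (T0 y)),
    exists w (s : hom y w) (b : hom x w),
      is_iso (T _ _ s) /\ T _ _ s ∘ F = T _ _ b;
  loc_zero : forall (x y : A) (f : hom x y), T _ _ f = 0 ->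
    exists w (s : hom w x), is_iso (T _ _ s) /\ f ∘ s = 0;
  loc_cozero : forall (x y : A) (f : hom x y), T _ _ f = 0 ->
    exists w (s : hom y w), is_iso (T _ _ s) /\ s ∘ f = 0 }.

Lemma opcat_localization (A Q : precat k) (T0 : A -> Q)
    (T : forall x y, hom x y -> hom (T0 x) (T0 y)) :
  is_localization T ->
  @is_localization (opcat A) (opcat Q) T0 (fun x y => T y x).
Proof.
case=> lo li lc ll lr lcr lz lcz; split=> //=.
- move=> x y F; have [w [s [b [/opcat_iso is_s e]]]] := lcr _ _ F.
  by exists w, s, b.
- move=> x y F; have [w [s [b [/opcat_iso is_s e]]]] := lr _ _ F.
  by exists w, s, b.
- move=> x y F e; have [w [s [/opcat_iso is_s e']]] := lcz _ _ F e.
  by exists w, s.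
- move=> x y F e; have [w [s [/opcat_iso is_s e']]] := lz _ _ F e.
  by exists w, s.
Qed.

Section LocExact.
Variables (A Q : precat k) (T0 : A -> Q).
Variable T : forall x y, hom x y -> hom (T0 x) (T0 y).
Hypothesis hA : is_linear_abelian A.
Hypothesis hQ : is_linear_cat Q.
Hypothesis hT : is_localization T.
Implicit Types x y z w : A.

Let hL : is_linear_cat A := hA.

Lemma loc0 x y : T (0 : hom x y) = 0.
Proof.
have := loc_linear hT (-1) (0 : hom x y) 0.
by rewrite scaler0 addr0 scaleN1r addNr.
Qed.

Lemma locD x y (f g : hom x y) : T (f + g) = T f + T g.
Proof. by have := loc_linear hT 1 f g; rewrite !scale1r. Qed.

Lemma loc_iso x y (f : hom x y) : is_iso f -> is_iso (T f).
Proof.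
by move=> [g [gf fg]]; exists (T g); rewrite -!(loc_comp hT) gf fg !(loc_id hT).
Qed.

(** If T f kills G = T b T(s)^-1, then T (f b) = 0, hence f b s' = 0 and b s' =
    0 for an s' inverted by T, so that T b = 0. *)
Lemma loc_mono x y (f : hom x y) : is_mono f -> is_mono (T f).
Proof.
move=> mf; apply: (mono0P hQ) => V G.
have [v ev] := loc_ob hT V; subst V => fG.
have [w [s [b [is_s e]]]] := loc_roof hT G.
have fb : T (f ∘ b) = 0.
  by rewrite (loc_comp hT) -e (cat_compA hQ) fG (comp0f hQ).
have [w' [s' [is_s' e']]] := loc_zero hT fb.
have bs' : b ∘ s' = 0 by apply: (mono_eq0 hL mf); rewrite (cat_compA hL).
apply: (epi_eq0 hQ (iso_epi hQ is_s)); rewrite e.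
apply: (epi_eq0 hQ (iso_epi hQ is_s')).
by rewrite -(loc_comp hT) bs' loc0.
Qed.

(** A morphism T b T(s)^-1 killed by T f has f b s' = 0 for an s' inverted by
    T, so b s' factors through the kernel j of f in A. *)
Lemma loc_kernel x y w (f : hom x y) (j : hom w x) :
  is_kernel f j -> is_kernel (T f) (T j).
Proof.
move=> kj; apply: kernelP.
- exact: (loc_mono (kernel_mono hL kj)).
- by rewrite -(loc_comp hT) kj.1 loc0.
- move=> V G; have [v ev] := loc_ob hT V; subst V => fG.
  have [u [s [b [is_s e]]]] := loc_roof hT G.
  have fb : T (f ∘ b) = 0.
    by rewrite (loc_comp hT) -e (cat_compA hQ) fG (comp0f hQ).
  have [u' [s' [is_s' e']]] := loc_zero hT fb.
  have [|t et] := kernel_lift (t := b ∘ s') kj; first by rewrite (cat_compA hL).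
  have [r [rs sr]] := iso_comp hQ is_s is_s'.
  exists (T t ∘ r).
  rewrite (cat_compA hQ) -(loc_comp hT) et (loc_comp hT) -e.
  by rewrite -(cat_compA hQ G) -(cat_compA hQ G) sr (cat_compf1 hQ).
Qed.

Lemma loc_zero_ob x : is_zero_ob x -> is_zero_ob (T0 x).
Proof.
move=> /(zero_obP hL) hx; apply/(zero_obP hQ).
by rewrite -(loc_id hT) hx loc0.
Qed.

Lemma loc_biproduct x y s : is_biproduct x y s ->
  is_biproduct (T0 x) (T0 y) (T0 s).
Proof.
move=> [i1 [i2 [p1 [p2 [h11 h22 h12 h21 hd]]]]].
exists (T i1), (T i2), (T p1), (T p2); rewrite -!(loc_comp hT).
split; rewrite ?h11 ?h22 ?h12 ?h21 ?loc0 ?(loc_id hT) //.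
by rewrite -locD hd (loc_id hT).
Qed.

Lemma loc_has_kernel (X Y : Q) (F : hom X Y) :
  exists W (J : hom W X), is_kernel F J.
Proof.
have [x ex] := loc_ob hT X; have [y ey] := loc_ob hT Y; subst X Y.
have [w [s [b [is_s e]]]] := loc_roof hT F.
have [v [j kj]] := ab_kernel hA b.
exists (T0 v), (T s ∘ T j); apply: (kernel_precomp_iso hQ is_s).
by rewrite e; exact: loc_kernel.
Qed.

End LocExact.

Section LocAbelian.
Variables (A Q : precat k) (T0 : A -> Q).
Variable T : forall x y, hom x y -> hom (T0 x) (T0 y).
Hypothesis hA : is_linear_abelian A.
Hypothesis hQ : is_linear_cat Q.
Hypothesis hT : is_localization T.
Implicit Types x y z w : A.

Let hL : is_linear_cat A := hA.

Lemma loc_cokernel x y w (f : hom x y) (c : hom y w) :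
  is_cokernel f c -> is_cokernel (T f) (T c).
Proof.
exact: (loc_kernel (opcat_abelian hA) (opcat_linear hQ)
  (opcat_localization hT)).
Qed.

Lemma loc_short_exact x y z (i : hom x y) (p : hom y z) :
  short_exact i p -> short_exact (T i) (T p).
Proof. by move=> [ki kp]; split; [exact: loc_kernel | exact: loc_cokernel]. Qed.

(** Write F = T b T(s)^-1 and b = m c with c epi, m mono. The kernel of b
    becomes the kernel of the monomorphism T b, so it becomes zero and its
    cokernel c becomes invertible. *)
Lemma loc_mono_lift (X : Q) y (F : hom X (T0 y)) : is_mono F ->
  exists x (m : hom x y) (S : hom X (T0 x)),
    [/\ is_mono m, is_iso S & F = T m ∘ S].
Proof.
have [x ex] := loc_ob hT X; subst X => mF.
have [w [s [b [is_s e]]]] := loc_roof hT F.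
have [v [I [j [c [m [kj sjc mm mc]]]]]] := image_short_exact hA b.
have Tj0 : T j = 0.
  apply: (kernel_of_mono_eq0 hQ (f := T b)); last exact: loc_kernel.
  by rewrite -e; apply: (mono_comp hQ mF); exact: (iso_mono hQ).
have iso_c : is_iso (T c).
  by have := loc_cokernel sjc.2; rewrite Tj0 => /(cokernel0_iso hQ).
have [r [rs sr]] := is_s.
exists I, m, (T c ∘ r); split=> //.
  by apply: (iso_comp hQ iso_c); exists (T s).
rewrite (cat_compA hQ) -(loc_comp hT) mc -e -(cat_compA hQ) sr.
by rewrite (cat_compf1 hQ).
Qed.

Lemma loc_mono_normal (X Y : Q) (F : hom X Y) : is_mono F ->
  exists W (G : hom Y W), is_kernel G F.
Proof.
have [y ey] := loc_ob hT Y; subst Y => mF.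
have [x [m [S [mm is_S ->]]]] := loc_mono_lift mF.
have [z [c smc]] := mono_short_exact hA mm.
exists (T0 z), (T c); apply: (kernel_sub_iso hQ is_S).
exact: loc_kernel smc.1.
Qed.

(** The first map is T i up to an isomorphism, with i monic; both its cokernel
    T p and the second map are cokernels of it, so they differ by an
    isomorphism. *)
Lemma loc_short_exact_lift (X : Q) y (Z : Q) (F : hom X (T0 y))
    (G : hom (T0 y) Z) : short_exact F G ->
  exists x z (i : hom x y) (p : hom y z) (S : hom X (T0 x)) (R : hom (T0 z) Z),
    [/\ short_exact i p, is_iso S, is_iso R, F = T i ∘ S & G = R ∘ T p].
Proof.
move=> [kF kG].
have [x [i [S [mi is_S eF]]]] := loc_mono_lift (kernel_mono hQ kF).
have [z [p sip]] := mono_short_exact hA mi.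
have kp : is_cokernel F (T p).
  rewrite eF; apply: (cokernel_epi_precomp hQ (iso_epi hQ is_S)).
  exact: loc_cokernel sip.2.
have [R [is_R eR]] := cokernel_unique hQ kp kG.
by exists x, z, i, p, S, R.
Qed.

End LocAbelian.

Lemma loc_abelian (A Q : precat k) (T0 : A -> Q)
    (T : forall x y, hom x y -> hom (T0 x) (T0 y)) :
  is_linear_abelian A -> is_linear_cat Q -> is_localization T ->
  is_linear_abelian Q.
Proof.
move=> hA hQ hT.
have [hAo hQo] := (opcat_abelian hA, opcat_linear hQ).
have hTo := opcat_localization hT; split=> //.
- have [z hz] := ab_zero hA; exists (T0 z); exact: (loc_zero_ob hA hQ hT).
- move=> X Y; have [x ex] := loc_ob hT X; have [y ey] := loc_ob hT Y; subst X Y.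
  have [s hs] := ab_biproduct hA x y; exists (T0 s).
  exact: (loc_biproduct hT).
- exact: (loc_has_kernel hA hQ hT).
- by move=> X Y F; exact: (loc_has_kernel hAo hQo hTo).
- exact: (loc_mono_normal hA hQ hT).
- by move=> X Y F; exact: (loc_mono_normal hAo hQo hTo).
Qed.

End Localization.

(** * Monomorphisms and epimorphisms modulo C *)

Section ModCMore.
Variables (k : fieldType) (A : precat k) (C : A -> Prop).
Hypothesis hA : is_linear_abelian A.
Hypothesis hC : is_serre C.
Implicit Types x y z w : A.

Let hL : is_linear_cat A := hA.
Let compA := cat_compA hL.

Lemma mono_modC_compr x y z (i : hom y z) (u : hom x y) :
  is_mono i -> mono_modC C (i ∘ u) -> mono_modC C u.
Proof.
move=> mi /(mono_modC_kernel hA) [w [c [kc _ Cw]]].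
apply: (kernel_modC hA hC (f := c ∘ i) _ Cw); apply: kernelP.
- exact: (mono_compr hL (kernel_mono hL kc)).
- by rewrite -compA kc.1.
- move=> v t; rewrite -compA => /(kernel_lift kc) [s es]; exists s.
  by apply: mi; rewrite compA.
Qed.

(** f u factors through the kernel of w, an object of C, and the kernel of a
    morphism to an object of C has its cokernel in C. *)
Lemma modC_kill x' x y y' (u : hom x' x) (f : hom x y) (w : hom y y') :
  mono_modC C u -> epi_modC C w -> w ∘ f ∘ u = 0 ->
  exists v (s : hom v x), mono_modC C s /\ f ∘ s = 0.
Proof.
move=> hu [_ [z [l [kl Cz]]]]; rewrite -compA => /(kernel_lift kl) [c ec].
have [v [j kj]] := ab_kernel hA c; exists v, (u ∘ j); split.
  exact: (mono_modC_comp hA hC hu (kernel_modC hA hC kj Cz)).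
by rewrite compA -ec -compA kj.1 (compf0 hL).
Qed.

Lemma epi_modC_pull x y z (f : hom x z) (p : hom y z) : epi_modC C p ->
  exists w (s : hom w x) (b : hom w y), epi_modC C s /\ p ∘ b = f ∘ s.
Proof.
move=> [ep [c [j [kj Cc]]]].
have [w [s [b [es eb inj]]]] := epi_pull hA f ep; exists w, s, b; split=> //.
split=> //; have [v [n kn]] := ab_kernel hA s; exists v, n; split=> //.
have [|t et] := kernel_lift (t := b ∘ n) kj.
  by rewrite compA eb -compA kn.1 (compf0 hL).
apply: (serre_sub hC (i := t)) => //; apply: (mono0P hL) => u q tq.
apply: (mono_eq0 hL (kernel_mono hL kn)); apply: inj.
  by rewrite compA kn.1 (comp0f hL).
by rewrite compA -et -compA tq (compf0 hL).
Qed.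

(** A zero morphism is a monomorphism modulo C only to objects of C: its
    cokernel is monic on [y]. With [mono_modC0], this detects the objects that
    become zero in A/C. *)
Lemma mono_modC_eq0 x y (s : hom x y) : mono_modC C s -> s = 0 -> C y.
Proof.
move=> /(mono_modC_kernel hA) [w [c [kc _ Cw]]] s0.
exact: (serre_sub hC (kernel_eq0_mono hL kc s0) Cw).
Qed.

Lemma mono_modC0 x : C x -> exists w, mono_modC C (0 : hom w x).
Proof.
move=> Cx; have [w [j kj]] := ab_kernel hA (idm x); exists w.
have <- : j = 0 by rewrite -(cat_comp1f hL j) kj.1.
exact: (kernel_modC hA hC kj Cx).
Qed.

(** Replace x by a proper subobject with cokernel in C as long as there is one;
    the bound on chains stops this.  Any other such subobject then meets the
    last one in all of it. *)
Lemma initial_mono_modC n x : chain_bound n x ->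
  exists d (i : hom d x), mono_modC C i /\
    forall e (j : hom e x), mono_modC C j -> exists s : hom d e, j ∘ s = i.
Proof.
elim: n x => [|n IH] x bx.
  exists x, (idm x); split; first exact: mono_modC_id.
  by move=> e j _; exists 0; rewrite (compf0 hL) ((bx x).1 (idm x)).
have [[d [i [hi nis]]]|all_iso] := pselect (exists d (i : hom d x),
    mono_modC C i /\ ~ is_iso i); last first.
  exists x, (idm x); split; first exact: mono_modC_id.
  move=> e j hj; have [[s [_ js]]|nis] := pselect (is_iso j); first by exists s.
  by case: all_iso; exists e, j.
have [//|bd] := bx d i hi.1.
have [d0 [i0 [hi0 min]]] := IH d bd.
exists d0, (i ∘ i0); split; first exact: mono_modC_comp.
move=> e j hj.
have [w [u [v [eq huv]]]] := mono_modC_cap hA hC hi hj.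
have [s es] := min w u (mono_modC_compr hi.1 huv).
by exists (v ∘ s); rewrite -es compA -eq compA.
Qed.

End ModCMore.

Section ModCMoreDual.
Variables (k : fieldType) (A : precat k) (C : A -> Prop).
Hypothesis hA : is_linear_abelian A.
Hypothesis hC : is_serre C.
Implicit Types x y z w : A.

Let hAop := opcat_abelian hA.
Let hCop := opcat_serre hC.

Lemma modC_cokill x' x y y' (u : hom x' x) (f : hom x y) (w : hom y y') :
  mono_modC C u -> epi_modC C w -> w ∘ f ∘ u = 0 ->
  exists v (s : hom y v), epi_modC C s /\ s ∘ f = 0.
Proof.
move=> hu hw; rewrite -(cat_compA hA).
exact: (modC_kill (u := (w : @hom k (opcat A) y' y)) hAop hCop hw hu).
Qed.

Lemma mono_modC_push x y z (f : hom z x) (i : hom z y) : mono_modC C i ->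
  exists w (s : hom x w) (b : hom y w), mono_modC C s /\ b ∘ i = s ∘ f.
Proof. exact: (epi_modC_pull hAop hCop). Qed.

Lemma terminal_epi_modC n x : @chain_bound k (opcat A) n x ->
  exists d (p : hom x d), epi_modC C p /\
    forall e (q : hom x e), epi_modC C q -> exists s : hom e d, s ∘ q = p.
Proof. exact: (initial_mono_modC hAop hCop). Qed.

End ModCMoreDual.

(** * The category of fractions *)

Section QuotientCategory.
Variables (k : fieldType) (A : precat k) (C : A -> Prop).
Hypothesis hA : is_linear_abelian A.
Hypothesis hC : is_serre C.
Implicit Types M N P : A.

Let hL : is_linear_cat A := hA.
Let compA := cat_compA hL.

Local Notation Q := (serre_quotient hA hC).
Local Notation T := (qfunctor hA hC).
Local Notation "[ f ]q" := (qclass hA hC f : @hom k Q _ _)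
  (at level 0, f at level 99).

Lemma qclass_le M N (r s : frac C M N) : frac_le r s -> [r]q = [s]q.
Proof. by move=> h; apply/qclassP; exact: frac_le_eq. Qed.

Lemma qclass_ext M N D R (i i' : hom D M) (p p' : hom N R) (f f' : hom D R)
    (hi : mono_modC C i) (hp : epi_modC C p) (hi' : mono_modC C i')
    (hp' : epi_modC C p') :
  i = i' -> p = p' -> f = f' -> [Frac f hi hp]q = [Frac f' hi' hp']q.
Proof.
move=> e1 e2 e3; apply: qclass_le; exists (idm _), (idm _) => /=.
by rewrite !(cat_compf1 hL) !(cat_comp1f hL).
Qed.

(** In this case the image occurring in Gabriel's composition is the domain of g
    itself, and any stage on which u lifts to that domain may be used. *)
Lemma qcomp_precomp M N P D (g : frac C N P) (u : hom M N) (i : hom D M)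
    (hi : mono_modC C i) (u' : hom D (fdom g)) :
  finc g ∘ u' = u ∘ i ->
  ([g]q : @hom k Q N P) ∘ T u = [Frac (fmap g ∘ u') hi (fprj_modC g)]q.
Proof.
move=> e; apply: qcompE.
exists (fdom g), (idm _), (finc g), i, u', (idm _), (fmap g).
rewrite /= !(cat_compf1 hL) !(cat_comp1f hL); split=> //; split=> //.
  exact: (epi_modC_id hA hC _).1.
exact: (finc_modC g).1.
Qed.

Lemma qcomp_postcomp M N P R (f : frac C M N) (w : hom N P) (p : hom P R)
    (hp : epi_modC C p) (w' : hom (fcod f) R) :
  w' ∘ fprj f = p ∘ w ->
  T w ∘ [f]q = [Frac (w' ∘ fmap f) (finc_modC f) hp]q.
Proof.
move=> e; apply: qcompE.
exists (fcod f), (fprj f), (idm _), (idm _), (fmap f), p, w'.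
rewrite /= !(cat_compf1 hL) !(cat_comp1f hL); split=> //; split=> //.
  exact: (fprj_modC f).1.
exact: (mono_modC_id hA hC _).1.
Qed.

Lemma qfunctor_comp M N P (g : hom N P) (f : hom M N) : T (g ∘ f) = T g ∘ T f.
Proof.
rewrite [RHS](qcomp_precomp (g := frac_of hA hC g) (u' := f)
  (mono_modC_id hA hC M)) /=.
  exact: qclass_ext.
by rewrite (cat_comp1f hL) (cat_compf1 hL).
Qed.

Lemma qcompf1 M N (F : @hom k Q M N) : F ∘ idm (M : Q) = F.
Proof.
rewrite -(qreprK F); case: (qrepr F) => D R i p f hi hp.
rewrite (@qcomp_precomp M M N D (Frac f hi hp) (idm M) i hi (idm D)) /=.
  by apply: qclass_ext; rewrite ?(cat_compf1 hL).
by rewrite (cat_comp1f hL) (cat_compf1 hL).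
Qed.

Lemma qcomp1f M N (F : @hom k Q M N) : idm (N : Q) ∘ F = F.
Proof.
rewrite -(qreprK F); case: (qrepr F) => D R i p f hi hp.
rewrite (@qcomp_postcomp M N N R (Frac f hi hp) (idm N) p hp (idm R)) /=.
  by apply: qclass_ext; rewrite ?(cat_comp1f hL).
by rewrite (cat_comp1f hL) (cat_compf1 hL).
Qed.

Definition mono_inv M D (i : hom D M) (hi : mono_modC C i) : @hom k Q M D :=
  [Frac (idm D) hi (epi_modC_id hA hC D)]q.

Definition epi_inv N R (p : hom N R) (hp : epi_modC C p) : @hom k Q R N :=
  [Frac (idm R) (mono_modC_id hA hC R) hp]q.

Lemma mono_invK M D (i : hom D M) (hi : mono_modC C i) :
  mono_inv hi ∘ T i = idm (D : Q).
Proof.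
rewrite (qcomp_precomp (g := Frac (idm D) hi (epi_modC_id hA hC D))
  (u' := idm D) (mono_modC_id hA hC D)) //=.
by apply: qclass_ext; rewrite ?(cat_comp1f hL).
Qed.

Lemma mono_invKV M D (i : hom D M) (hi : mono_modC C i) :
  T i ∘ mono_inv hi = idm (M : Q).
Proof.
rewrite (qcomp_postcomp (f := Frac (idm D) hi (epi_modC_id hA hC D))
  (w' := i) (epi_modC_id hA hC M)) /=; last first.
  by rewrite (cat_comp1f hL) (cat_compf1 hL).
apply/esym/qclass_le; exists i, (idm M); split=> /=.
- by rewrite (cat_comp1f hL).
- by rewrite (cat_comp1f hL).
- by rewrite (cat_compf1 hL) !(cat_comp1f hL).
Qed.

Lemma epi_invK N R (p : hom N R) (hp : epi_modC C p) :
  epi_inv hp ∘ T p = idm (N : Q).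
Proof.
rewrite (qcomp_precomp (g := Frac (idm R) (mono_modC_id hA hC R) hp)
  (u' := p) (mono_modC_id hA hC N)) /=; last first.
  by rewrite (cat_comp1f hL) (cat_compf1 hL).
apply/esym/qclass_le; exists (idm N), p; split=> /=.
- by rewrite (cat_comp1f hL).
- by rewrite (cat_compf1 hL).
- by rewrite (cat_comp1f hL) !(cat_compf1 hL).
Qed.

Lemma epi_invKV N R (p : hom N R) (hp : epi_modC C p) :
  T p ∘ epi_inv hp = idm (R : Q).
Proof.
rewrite (qcomp_postcomp (f := Frac (idm R) (mono_modC_id hA hC R) hp)
  (w' := idm R) (epi_modC_id hA hC R)) //=.
by apply: qclass_ext; rewrite ?(cat_comp1f hL).
Qed.

Lemma qclass_factor M N D R (i : hom D M) (p : hom N R) (f : hom D R)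
    (hi : mono_modC C i) (hp : epi_modC C p) :
  [Frac f hi hp]q = epi_inv hp ∘ (T f ∘ mono_inv hi).
Proof.
rewrite (qcomp_postcomp (f := Frac (idm D) hi (epi_modC_id hA hC D))
  (w' := f) (epi_modC_id hA hC R)) /=; last first.
  by rewrite (cat_comp1f hL) (cat_compf1 hL).
apply/esym; apply: qcompE.
exists R, (idm R), (idm R), (idm D), f, (idm _), (idm R) => /=.
rewrite !(cat_compf1 hL) !(cat_comp1f hL); split=> //; split=> //.
- exact: (epi_modC_id hA hC _).1.
- exact: (mono_modC_id hA hC _).1.
Qed.

(** Every morphism of A/C is T(p)^-1 T(f) T(i)^-1, so a property stable under
    composition need be checked on the three kinds of factors only. *)
Lemma qhom_ind (P : forall M N, @hom k Q M N -> Prop) :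
  (forall M N (f : hom M N), P _ _ (T f)) ->
  (forall M D (i : hom D M) (hi : mono_modC C i), P _ _ (mono_inv hi)) ->
  (forall N R (p : hom N R) (hp : epi_modC C p), P _ _ (epi_inv hp)) ->
  (forall M N L (G : @hom k Q N L) (F : @hom k Q M N),
     P _ _ G -> P _ _ F -> P _ _ (G ∘ F)) ->
  forall M N (F : @hom k Q M N), P _ _ F.
Proof.
move=> PT Pi Pp Pc M N F.
rewrite -(qreprK F); case: (qrepr F) => D R i p f hi hp.
by rewrite qclass_factor; do !apply: (Pc).
Qed.

(** Pull the stage of the composite h g back along f.  The factorization through
    the image I chosen for h g also computes the composite of h with g T f. *)
Lemma qcomp_qfunctorA M N P R (H : @hom k Q P R) (G : @hom k Q N P)
  (f : hom M N) : H ∘ (G ∘ T f) = H ∘ G ∘ T f.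
Proof.
rewrite -(qreprK H) -(qreprK G); move: (qrepr H) (qrepr G) => h g.
have [hg] := frac_comp_ex hA hC h g.
move=> hgP; rewrite (qcompE hA hC hgP : [h]q ∘ [g]q = [hg]q).
move: hgP => [I [e [m [u [v [w [h' [[ee mm em] [ei ep] ev eh' ef]]]]]]]].
have [D [i [f' [hi eif]]]] := mono_modC_pull hA hC f (finc_modC hg).
rewrite (qcomp_precomp hi eif).
have e1 : finc g ∘ (u ∘ f') = f ∘ i by rewrite compA -ei.
rewrite (qcomp_precomp hi e1).
apply: qcompE; exists I, e, m, (idm D), (v ∘ f'), w, h'; split=> //=.
- by rewrite (cat_compf1 hL).
- by rewrite (cat_compf1 hL) !compA ev.
- by rewrite ef compA.
Qed.

Lemma qcomp_mono_cancel M N D (i : hom D M) (hi : mono_modC C i)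
  (F F' : @hom k Q M N) : F ∘ T i = F' ∘ T i -> F = F'.
Proof.
have [D1 [R [j [p [hj [hp [f [f' [-> ->]]]]]]]]] := qhom_stage2 F F'.
have [w [u [v [eq huv]]]] := mono_modC_cap hA hC hi hj.
have hu := mono_modC_compr hA hC hi.1 huv.
rewrite (@qcomp_precomp _ _ _ _ (Frac f hj hp) i u hu v) //.
rewrite (@qcomp_precomp _ _ _ _ (Frac f' hj hp) i u hu v) //=.
move/qclassP => [t [[a [b [/= e1 e2 e3]]] [a' [b' [/= e1' e2' e3']]]]].
have ha : mono_modC C (j ∘ (v ∘ a)).
  have -> : j ∘ (v ∘ a) = i ∘ finc t by rewrite compA -eq e1 compA.
  exact: (mono_modC_comp hA hC hi (finc_modC t)).
have eb : b = b' by apply: hp.1; rewrite -e2 -e2'.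
have ea : a = a' by apply: hu.1; rewrite -e1 -e1'.
have := fprj_modC t; rewrite e2 => hbp.
transitivity ([Frac (b ∘ f ∘ (v ∘ a)) ha hbp]q).
  by apply: qclass_le; exists (v ∘ a), b.
apply/esym/qclass_le; exists (v ∘ a), b; split=> //=.
by move: e3'; rewrite e3 -ea -eb !compA.
Qed.

(** The two composites agree on a stage of M.  Its image m in N is again a stage
    of N, contained in the common domain of F and F', and there the two
    numerators agree because the map onto the image is epi. *)
Lemma qcomp_epi_cancel M N L (p : hom M N) (hp : epi_modC C p)
  (F F' : @hom k Q N L) : F ∘ T p = F' ∘ T p -> F = F'.
Proof.
have [D [R [i [q [hi [hq [f [f' [-> ->]]]]]]]]] := qhom_stage2 F F'.
have [w [u [v [hu eq]]]] := mono_modC_pull hA hC p hi.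
rewrite (qcomp_precomp (g := Frac f hi hq) hu eq).
rewrite (qcomp_precomp (g := Frac f' hi hq) hu eq) /=.
move/qclassP => [t [[a [b [/= e1 e2 e3]]] [a' [b' [/= e1' e2' e3']]]]].
have eb : b = b' by apply: hq.1; rewrite -e2 -e2'.
have ea : a = a' by apply: hu.1; rewrite -e1 -e1'.
have [J [e [m [ee mm em]]]] := image_ex hA (p ∘ finc t).
have hm : mono_modC C m := mono_modC_image hA hC (finc_modC t) hp.1 ee mm em.
have [c [ce ic]] : exists c : hom J D, c ∘ e = v ∘ a /\ i ∘ c = m.
  by apply: (epi_mono_fill hA ee hi.1); rewrite em e1 !compA eq.
have bfc : b ∘ f ∘ c = b ∘ f' ∘ c.
  apply: ee; rewrite -!compA ce !compA.
  by move: e3'; rewrite e3 -ea -eb !compA.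
have hbq := fprj_modC t; rewrite e2 in hbq.
transitivity ([Frac (b ∘ f ∘ c) hm hbq]q).
  by apply: qclass_le; exists c, b.
by apply/esym/qclass_le; exists c, b; split=> //=.
Qed.

Lemma qcompA M N P R (H : @hom k Q P R) (G : @hom k Q N P) (F : @hom k Q M N) :
  H ∘ (G ∘ F) = H ∘ G ∘ F.
Proof.
suff : forall M N (F : @hom k Q M N) P R (H : @hom k Q P R) (G : @hom k Q N P),
  H ∘ (G ∘ F) = H ∘ G ∘ F by apply.
move=> {M N P R H G F}; apply: qhom_ind.
- by move=> M N f P R H G; exact: qcomp_qfunctorA.
- move=> M D i hi P R H G; apply: (qcomp_mono_cancel hi).
  by rewrite -!qcomp_qfunctorA mono_invK !qcompf1.
- move=> N D p hp P R H G.
  apply: (qcomp_epi_cancel hp).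
  by rewrite -!qcomp_qfunctorA epi_invK !qcompf1.
- move=> M N L G F hG hF P R H K.
  by rewrite !hF hG.
Qed.

End QuotientCategory.

(** * The quotient as a linear abelian category *)

Section QuotientLocalization.
Variables (k : fieldType) (A : precat k) (C : A -> Prop).
Hypothesis hA : is_linear_abelian A.
Hypothesis hC : is_serre C.
Implicit Types M N P : A.

Let hL : is_linear_cat A := hA.
Let compA := cat_compA hL.

Local Notation Q := (serre_quotient hA hC).
Local Notation T := (qfunctor hA hC).
Local Notation "[ f ]q" := (qclass hA hC f : @hom k Q _ _)
  (at level 0, f at level 99).

Lemma qlin_stage M N D R (i : hom D M) (p : hom N R) (hi : mono_modC C i)
    (hp : epi_modC C p) a (f g : hom D R) :
  [Frac (a *: f + g) hi hp]q = a *: [Frac f hi hp]q + [Frac g hi hp]q.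
Proof.
change ([Frac (a *: f + g) hi hp]q =
  qadd (qscale a (qclass hA hC (Frac f hi hp))) (qclass hA hC (Frac g hi hp))).
by rewrite qscale_stage qadd_stage.
Qed.

Lemma qcomp_qfunctor_linl M N P (f : hom M N) :
  linear (fun G : @hom k Q N P => G ∘ T f).
Proof.
move=> a G G'.
have [D [R [i [p [hi [hp [g [g' [-> ->]]]]]]]]] := qhom_stage2 G G'.
have [w [u [v [hu eq]]]] := mono_modC_pull hA hC f hi.
have pre h := qcomp_precomp hA hC (g := Frac h hi hp) hu eq.
rewrite -qlin_stage !pre /= -qlin_stage.
by apply: qclass_ext => //; rewrite (compDf hL) (compZf hL).
Qed.

Lemma qcomp_qfunctor_linr M N P (g : hom N P) :
  linear (fun F : @hom k Q M N => T g ∘ F).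
Proof.
move=> a F F'.
have [D [R [i [p [hi [hp [f [f' [-> ->]]]]]]]]] := qhom_stage2 F F'.
have [w [u [v [hu eq]]]] := epi_modC_push hA hC g hp.
have post h := qcomp_postcomp hA hC (f := Frac h hi hp) hu eq.
rewrite -qlin_stage !post /= -qlin_stage.
by apply: qclass_ext => //; rewrite (compfD hL) (compfZ hL).
Qed.

Lemma qcomp_linl M N P (F : @hom k Q M N) :
  linear (fun G : @hom k Q N P => G ∘ F).
Proof.
move: P; apply: (qhom_ind (P := fun M N F => forall P,
  linear (fun G : @hom k Q N P => G ∘ F))) F => {M N}.
- by move=> M N f P; exact: qcomp_qfunctor_linl.
- move=> M D i hi P a G G'; apply: (qcomp_mono_cancel hi).
  by rewrite qcomp_qfunctor_linl -!qcompA mono_invK !qcompf1.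
- move=> M D p hp P a G G'; apply: (qcomp_epi_cancel hp).
  by rewrite qcomp_qfunctor_linl -!qcompA epi_invK !qcompf1.
- by move=> M N L G F hG hF P a K K'; rewrite !qcompA hG hF.
Qed.

Lemma qcomp_linr M N P (G : @hom k Q N P) :
  linear (fun F : @hom k Q M N => G ∘ F).
Proof.
have inv_linr X Y (S : @hom k Q X Y) (S' : @hom k Q Y X) :
    S' ∘ S = idm (X : Q) -> S ∘ S' = idm (Y : Q) ->
    (forall L, linear (fun F : @hom k Q L X => S ∘ F)) ->
    forall L, linear (fun F : @hom k Q L Y => S' ∘ F).
  move=> S'S SS' linS L a F F'.
  by rewrite -[RHS]qcomp1f -S'S -qcompA linS !qcompA SS' !qcomp1f.
move: M; apply: (qhom_ind (P := fun N P G => forall M,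
  linear (fun F : @hom k Q M N => G ∘ F))) G => {N P}.
- by move=> N P g M; exact: qcomp_qfunctor_linr.
- move=> N D i hi; apply: (inv_linr _ _ (T i) (mono_inv hA hC hi)) => [||L].
  + exact: mono_invK.
  + exact: mono_invKV.
  + exact: qcomp_qfunctor_linr.
- move=> N D p hp; apply: (inv_linr _ _ (T p) (epi_inv hA hC hp)) => [||L].
  + exact: epi_invK.
  + exact: epi_invKV.
  + exact: qcomp_qfunctor_linr.
- by move=> M N L G F hG hF P a K K'; rewrite -!qcompA hF hG.
Qed.

Lemma serre_quotient_linear : is_linear_cat Q.
Proof.
split.
- by move=> *; exact: qcompA.
- by move=> *; exact: qcomp1f.
- by move=> *; exact: qcompf1.
- by move=> *; exact: qcomp_linl.
- by move=> *; exact: qcomp_linr.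
Qed.

Lemma qfunctor_mono_iso M D (i : hom D M) : mono_modC C i -> is_iso (T i).
Proof.
by move=> hi; exists (mono_inv hA hC hi); rewrite mono_invK mono_invKV.
Qed.

Lemma qfunctor_epi_iso N R (p : hom N R) : epi_modC C p -> is_iso (T p).
Proof. by move=> hp; exists (epi_inv hA hC hp); rewrite epi_invK epi_invKV. Qed.

Lemma qclass_eq0 M N D R (i : hom D M) (p : hom N R) (hi : mono_modC C i)
    (hp : epi_modC C p) (f : hom D R) : [Frac f hi hp]q = 0 ->
  exists D' R' (u : hom D' D) (w : hom R R'),
    [/\ mono_modC C (i ∘ u), epi_modC C (w ∘ p) & w ∘ f ∘ u = 0].
Proof.
move=> e; have : [Frac f hi hp]q = [Frac 0 hi hp]q.
  by rewrite e; exact: (qzero_stage hA hC hi hp).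
move/qclassP=> [t [[a [b [/= e1 e2 e3]]] [a' [b' [/= _ _ e3']]]]].
exists (fdom t), (fcod t), a, b; split.
- by rewrite -e1; exact: finc_modC.
- by rewrite -e2; exact: fprj_modC.
- by rewrite -e3 e3' (compf0 hL) (comp0f hL).
Qed.

Lemma qfunctor_eq0 M N (f : hom M N) : T f = 0 ->
  exists D R (u : hom D M) (w : hom N R),
    [/\ mono_modC C u, epi_modC C w & w ∘ f ∘ u = 0].
Proof.
move/qclass_eq0=> [D [R [u [w]]]]; rewrite (cat_comp1f hL) (cat_compf1 hL).
by exists D, R, u, w.
Qed.

Lemma qclass_numerator M N (F : @hom k Q M N) :
  exists D R (i : hom D M) (p : hom N R) (f : hom D R),
    [/\ mono_modC C i, epi_modC C p & T p ∘ F ∘ T i = T f].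
Proof.
rewrite -(qreprK F); case: (qrepr F) => D R i p f hi hp.
exists D, R, i, p, f; split=> //.
by rewrite qclass_factor qcompA epi_invKV qcomp1f -qcompA mono_invK qcompf1.
Qed.

(** If F has numerator f : D -> R then T p F T i = T f. The pullback of p along
    f gives a right fraction, the pushout of i along f a left one. *)
Lemma serre_quotient_localization :
  @is_localization k A Q (fun x => x) (@qfunctor k A C hA hC).
Proof.
have hQ := serre_quotient_linear; split.
- by move=> X; exists X.
- by [].
- by move=> x y z g f; exact: qfunctor_comp.
- by move=> x y a f g; exact: qlin_stage.
- move=> x y F; have [D [R [i [p [f [hi hp e]]]]]] := qclass_numerator F.
  have [w [s [b [hs eb]]]] := epi_modC_pull hA hC f hp.
  exists w, (i ∘ s), b; rewrite qfunctor_comp; split.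
    exact: (iso_comp hQ (qfunctor_mono_iso hi) (qfunctor_epi_iso hs)).
  apply: (iso_mono hQ (qfunctor_epi_iso hp)).
  by rewrite -[RHS]qfunctor_comp eb qfunctor_comp -e !qcompA.
- move=> x y F; have [D [R [i [p [f [hi hp e]]]]]] := qclass_numerator F.
  have [w [s [b [hs eb]]]] := mono_modC_push hA hC f hi.
  exists w, (s ∘ p), b; rewrite qfunctor_comp; split.
    exact: (iso_comp hQ (qfunctor_mono_iso hs) (qfunctor_epi_iso hp)).
  apply: (iso_epi hQ (qfunctor_mono_iso hi)).
  by rewrite -[RHS]qfunctor_comp eb qfunctor_comp -e !qcompA.
- move=> x y f /qfunctor_eq0 [D [R [u [w [hu hw e]]]]].
  have [v [s [hs es]]] := modC_kill hA hC hu hw e.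
  by exists v, s; split=> //; exact: qfunctor_mono_iso.
- move=> x y f /qfunctor_eq0 [D [R [u [w [hu hw e]]]]].
  have [v [s [hs es]]] := modC_cokill hA hC hu hw e.
  by exists v, s; split=> //; exact: qfunctor_epi_iso.
Qed.

Lemma serre_quotient_abelian : is_linear_abelian Q.
Proof.
exact: (loc_abelian hA serre_quotient_linear serre_quotient_localization).
Qed.

(** * Local finiteness *)

Lemma qfunctor_zero_ob (x : A) : @is_zero_ob k Q x <-> C x.
Proof.
have hQ := serre_quotient_linear; split=> [/(zero_obP hQ) e|Cx].
  have [D [R [u [w [hu hw]]]]] := @qfunctor_eq0 x x (idm x) e.
  case/(modC_kill hA hC hu hw) => v [s [hs]]; rewrite (cat_comp1f hL) => s0.
  exact: (mono_modC_eq0 hA hC hs s0).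
have [w /qfunctor_mono_iso iso0] := mono_modC0 hA hC Cx.
apply/(zero_obP hQ); apply: (iso_epi hQ iso0).
by rewrite (comp0f hQ) (cat_comp1f hQ) (loc0 serre_quotient_localization).
Qed.

(** A subobject of T s is, up to isomorphism, the image of a subobject of s. *)
Lemma simple_quotient (s : A) : is_simple s -> ~ C s -> @is_simple k Q s.
Proof.
have [hQ hT] := (serre_quotient_linear, serre_quotient_localization).
move=> [_ ss] nCs; split; first by move/qfunctor_zero_ob.
move=> X F mF.
have [x [m [S [mm is_S ->]]]] := loc_mono_lift hA hQ hT mF.
case: (ss _ _ mm) => [hx|is_m].
  left; apply: (mono_zero_ob hQ (iso_mono hQ is_S)).
  exact: (loc_zero_ob hA hQ hT hx).
by right; apply: (iso_comp hQ _ is_S); exact: (loc_iso hT).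
Qed.

Lemma finite_length_quotient (x : A) :
  finite_length x -> @finite_length k Q x.
Proof.
have [hQ hT] := (serre_quotient_linear, serre_quotient_localization).
elim=> [z hz|y {}x s i p sip ss _ fy].
  by apply: FiniteLength0; exact: (loc_zero_ob hA hQ hT hz).
have sip' := loc_short_exact hA hQ hT sip.
have [/qfunctor_zero_ob Cs|nCs] := pselect (C s); last first.
  exact: (FiniteLengthS sip' (simple_quotient ss nCs)).
apply: (finite_length_iso hQ _ fy).
have p0 : T p = 0 by have [h _] := Cs x; exact: h.
by apply: (kernel0_iso hQ (y := s)); rewrite -p0; exact: sip'.1.
Qed.

(** The least subobject i with cokernel in C and the greatest quotient map p
    with kernel in C give the last stage of the direct system. No nonzero f
    dies later on, because every further stage u, w has a section and a
    retraction. *)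
Lemma qhom_terminal_stage M N : finite_length M -> finite_length N ->
  exists D R (i : hom D M) (p : hom N R) (hi : mono_modC C i)
      (hp : epi_modC C p),
    bijective (fun f : hom D R => [Frac f hi hp]q).
Proof.
move=> /(finite_length_chain_bound hA) [m bM].
move=> /(finite_length_cochain_bound hA) [n bN].
have [D [i [hi imin]]] := initial_mono_modC hA hC bM.
have [R [p [hp pmax]]] := terminal_epi_modC hA hC bN.
exists D, R, i, p, hi, hp.
have surj (F : @hom k Q M N) : exists f, [Frac f hi hp]q == F.
  rewrite -(qreprK F); case: (qrepr F) => D1 R1 i1 p1 f hi1 hp1.
  have [u eu] := imin _ _ hi1; have [w ew] := pmax _ _ hp1.
  exists (w ∘ f ∘ u); apply/eqP/esym/qclass_le; exists u, w => /=.
  by rewrite eu ew.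
have inj f : [Frac f hi hp]q = 0 -> f = 0.
  move=> /qclass_eq0 [D' [R' [u [w [hu hw e]]]]].
  have [s es] := imin _ _ hu; have [t et] := pmax _ _ hw.
  have us : u ∘ s = idm D.
    by apply: hi.1; rewrite compA es (cat_compf1 hL).
  have tw : t ∘ w = idm R.
    by apply: hp.1; rewrite -compA et (cat_comp1f hL).
  have -> : f = t ∘ (w ∘ f ∘ u) ∘ s.
    by rewrite !compA tw (cat_comp1f hL) -compA us (cat_compf1 hL).
  by rewrite e (compf0 hL) (comp0f hL).
exists (fun F => xchoose (surj F)) => [f|F]; last exact/eqP/(xchooseP (surj F)).
apply/eqP; rewrite -subr_eq0; apply/eqP; apply: inj.
have /eqP := xchooseP (surj [Frac f hi hp]q).
set g := xchoose _ => eg.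
by rewrite addrC -scaleN1r qlin_stage eg scaleN1r addNr.
Qed.

Lemma serre_quotient_locally_finite :
  is_locally_finite A -> is_locally_finite Q.
Proof.
move=> [fin_hom fin_len]; split; last first.
  by move=> x; exact: finite_length_quotient.
move=> M N.
have [D [R [i [p [hi [hp [g fK gK]]]]]]] :=
  qhom_terminal_stage (fin_len M) (fin_len N).
have [n [[v lin_v [v' vK v'K]]]] := fin_hom D R; exists n; constructor.
exists (fun F => v (g F)).
  move=> a F G; rewrite -lin_v; congr (v _).
  by apply: (can_inj fK); rewrite gK qlin_stage !gK.
by exists (fun r => [Frac (v' r) hi hp]q) => [F|r]; rewrite ?vK ?gK ?fK ?v'K.
Qed.

End QuotientLocalization.

(** * The monoidal structure *)

Lemma tens_iso (k : fieldType) (B : premonoidal k) (x1 y1 x2 y2 : B)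
    (f : hom x1 y1) (g : hom x2 y2) :
  is_monoidal B -> is_iso f -> is_iso g -> is_iso (f ⊠ g).
Proof.
move=> hB [f' [f'f ff']] [g' [g'g gg']]; exists (f' ⊠ g').
by rewrite -!(tens_comp hB) f'f ff' g'g gg' !(tens_id hB).
Qed.

Section QuotientMonoidal.
Variables (k : fieldType) (A : premonoidal k) (C : A -> Prop).
Hypothesis hA : is_multiring A.
Hypothesis hC : is_serre_tensor_ideal C.
Implicit Types M N P X Y : A.

Let hL : is_linear_cat A := hA.
Let hM := mr_monoidal hA.

Local Notation Q := (serre_quotient_mon hA hC).
Local Notation T := (qfunctor hA hC).
Local Notation "[ f ]q" := (qclass hA hC f : @hom k Q _ _)
  (at level 0, f at level 99).

Lemma qtens_qfunctor M N X Y (f : hom M N) (g : hom X Y) :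
  T (f ⊠ g) = (T f : @hom k Q M N) ⊠ (T g : @hom k Q X Y).
Proof.
rewrite [RHS](qtensE hA hC (frac_of hA hC f) (frac_of hA hC g)).
by apply: qclass_ext => //=; rewrite (tens_id hM).
Qed.

(** f ⊠ g = (idm ⊠ g) (f ⊠ idm), and each factor is monic by exactness in one
    variable. *)
Lemma tens_mono M N X Y (f : hom M N) (g : hom X Y) :
  is_mono f -> is_mono g -> is_mono (f ⊠ g).
Proof.
move=> mf mg.
rewrite -(cat_comp1f hL f) -(cat_compf1 hL g) (tens_comp hM).
have [z [c sc]] := mono_short_exact hA mf.
have [z' [c' sc']] := mono_short_exact hA mg.
apply: (mono_comp hL).
  by have [_ [kg _]] := mr_biexact hA N sc'; exact: (kernel_mono hL kg).
by have [[kf _] _] := mr_biexact hA X sc; exact: (kernel_mono hL kf).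
Qed.

Lemma tens_epi M N X Y (f : hom M N) (g : hom X Y) :
  is_epi f -> is_epi g -> is_epi (f ⊠ g).
Proof.
move=> ef eg.
rewrite -(cat_comp1f hL f) -(cat_compf1 hL g) (tens_comp hM).
have [z [j kj]] := ab_kernel hA f; have [z' [j' kj']] := ab_kernel hA g.
apply: (epi_comp hL).
  have [_ [_ cg]] := mr_biexact hA N (epi_kernel_short_exact hA eg kj').
  exact: (cokernel_epi hL cg).
have [[_ cf] _] := mr_biexact hA X (epi_kernel_short_exact hA ef kj).
exact: (cokernel_epi hL cf).
Qed.

(** The tensor product of two images is an image of the tensor product, and
    each equation defining Gabriel's composition is stable under the tensor
    product. *)
Lemma frac_comp_tens M N P X Y Z (g : frac C N P) (f : frac C M N)
    (h : frac C M P) (g' : frac C Y Z) (f' : frac C X Y) (h' : frac C X Z) :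
  frac_comp g f h -> frac_comp g' f' h' ->
  frac_comp (frac_tens hA hC g g') (frac_tens hA hC f f')
    (frac_tens hA hC h h').
Proof.
move=> [I [e [m [u [v [w [r [[ee mm em] [ei ep] ev er eh]]]]]]]].
move=> [I' [e' [m' [u' [v' [w' [r' [[ee' mm' em'] [ei' ep'] ev' er' eh']]]]]]]].
exists (I ⊗ I'), (e ⊠ e'), (m ⊠ m'), (u ⊠ u'), (v ⊠ v'), (w ⊠ w'), (r ⊠ r').
by split=> /=; rewrite -?(tens_comp hM) ?em ?em' ?ei ?ei' ?ep ?ep' ?ev ?ev'
  ?er ?er' ?eh ?eh' //; split=> //; [exact: tens_epi | exact: tens_mono].
Qed.

Lemma qtens_comp (x1 y1 z1 x2 y2 z2 : Q) (g1 : hom y1 z1) (f1 : hom x1 y1)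
    (g2 : hom y2 z2) (f2 : hom x2 y2) :
  (g1 ∘ f1) ⊠ (g2 ∘ f2) = (g1 ⊠ g2) ∘ (f1 ⊠ f2).
Proof.
rewrite -(qreprK g1) -(qreprK f1) -(qreprK g2) -(qreprK f2).
move: (qrepr g1) (qrepr f1) (qrepr g2) (qrepr f2) => {}g1 {}f1 {}g2 {}f2.
have [h1 c1] := frac_comp_ex hA hC g1 f1.
have [h2 c2] := frac_comp_ex hA hC g2 f2.
rewrite /= (qcompE hA hC c1) (qcompE hA hC c2) !qtensE.
by rewrite (qcompE hA hC (frac_comp_tens c1 c2)).
Qed.

(** Naturality of T a, T b with respect to fractions reduces to three squares in
    A: on the subobjects, on the quotients and on the numerators. *)
Lemma qnat_square M N X Y (a : hom N Y) (b : hom M X) (f : frac C M N)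
    (g : frac C X Y) (u : hom (fdom f) (fdom g)) (w : hom (fcod f) (fcod g)) :
  b ∘ finc f = finc g ∘ u -> w ∘ fprj f = fprj g ∘ a ->
  w ∘ fmap f = fmap g ∘ u -> T a ∘ [f]q = [g]q ∘ T b.
Proof.
move=> e1 e2 e3.
rewrite (qcomp_precomp hA hC (finc_modC f) (esym e1)).
rewrite (qcomp_postcomp hA hC (fprj_modC g) e2).
exact: qclass_ext.
Qed.

Lemma serre_quotient_monoidal : is_monoidal Q.
Proof.
have hQ := serre_quotient_linear hA hC.
have hT := serre_quotient_localization hA hC.
split.
- move=> x y.
  change ((T (idm (x : A)) : @hom k Q x x) ⊠ (T (idm (y : A)) : @hom k Q y y) =
    T (idm ((x : A) ⊗ (y : A)))).
  rewrite -(qtens_qfunctor (idm (x : A)) (idm (y : A))).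
  by rewrite (tens_id hM).
- exact: qtens_comp.
- move=> x1 y1 x2 y2 x3 y3 f1 f2 f3.
  rewrite -(qreprK f1) -(qreprK f2) -(qreprK f3) /= !qtensE.
  by apply: qnat_square => /=; exact: (assoc_nat hM).
- move=> x y f; rewrite -(qreprK f) /= qtensE.
  by apply: qnat_square => /=; exact: (lunit_nat hM).
- move=> x y f; rewrite -(qreprK f) /= qtensE.
  by apply: qnat_square => /=; exact: (runit_nat hM).
- by move=> x y z; exact: (loc_iso hT (assoc_iso hM x y z)).
- by move=> x; exact: (loc_iso hT (lunit_iso hM x)).
- by move=> x; exact: (loc_iso hT (runit_iso hM x)).
- move=> w x y z.
  have := congr1 (fun f => T f) (pentagon hM w x y z).
  by rewrite !qfunctor_comp !qtens_qfunctor.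
- move=> x y; have := congr1 (fun f => T f) (triangle hM x y).
  by rewrite !qfunctor_comp !qtens_qfunctor.
Qed.

Lemma serre_quotient_tensor_bilinear : tensor_bilinear Q.
Proof.
have [bl br] := mr_bilinear hA; split.
- move=> x1 y1 x2 y2 G a F F'.
  have [D [R [i [p [hi [hp [f [f' [-> ->]]]]]]]]] := qhom_stage2 F F'.
  rewrite -(qreprK G) -qlin_stage /= !qtensE /frac_tens /= -qlin_stage.
  by apply: qclass_ext => //=; rewrite bl.
- move=> x1 y1 x2 y2 F a G G'.
  have [D [R [i [p [hi [hp [g [g' [-> ->]]]]]]]]] := qhom_stage2 G G'.
  rewrite -(qreprK F) -qlin_stage /= !qtensE /frac_tens /= -qlin_stage.
  by apply: qclass_ext => //=; rewrite br.
Qed.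

Lemma qtens_split_idr (w x y z : Q) (F : hom y z) (G : hom x y) :
  (F ∘ G) ⊠ idm w = (F ⊠ idm w) ∘ (G ⊠ idm w).
Proof.
by rewrite -qtens_comp (cat_comp1f (serre_quotient_linear hA hC) (idm w)).
Qed.

Lemma qtens_split_idl (w x y z : Q) (F : hom y z) (G : hom x y) :
  idm w ⊠ (F ∘ G) = (idm w ⊠ F) ∘ (idm w ⊠ G).
Proof.
by rewrite -qtens_comp (cat_comp1f (serre_quotient_linear hA hC) (idm w)).
Qed.

(** Up to isomorphism a short exact sequence of A/C is the image of one of A,
    and the functor - ⊠ idm w of A/C restricts along T to that of A. *)
Lemma serre_quotient_tensor_biexact : tensor_biexact Q.
Proof.
have hQ := serre_quotient_linear hA hC.
have hT := serre_quotient_localization hA hC.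
have iso_id := iso_id hQ.
move=> w x y z F G /(loc_short_exact_lift hA hQ hT).
move=> [x' [z' [i [p [S [R [sip is_S is_R -> ->]]]]]]].
have [/(loc_short_exact hA hQ hT) sl /(loc_short_exact hA hQ hT) sr] :=
  mr_biexact hA w sip.
rewrite !(qtens_qfunctor) in sl sr.
split.
- rewrite (@qtens_split_idr w x x' y (T i) S).
  rewrite (@qtens_split_idr w y z' z R (T p)).
  apply: (short_exact_iso hQ _ _ sl).
    exact: (tens_iso serre_quotient_monoidal is_S (iso_id w)).
  exact: (tens_iso serre_quotient_monoidal is_R (iso_id w)).
- rewrite (@qtens_split_idl w x x' y (T i) S).
  rewrite (@qtens_split_idl w y z' z R (T p)).
  apply: (short_exact_iso hQ _ _ sr).
    exact: (tens_iso serre_quotient_monoidal (iso_id w) is_S).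
  exact: (tens_iso serre_quotient_monoidal (iso_id w) is_R).
Qed.

End QuotientMonoidal.

Theorem proposition4p9 (k : closedFieldType) (A : premonoidal k)
    (hA : is_multiring A) (C : A -> Prop) (hC : is_serre_tensor_ideal C) :
  is_multiring (serre_quotient_mon hA hC).
Proof.
split.
- exact: serre_quotient_abelian.
- exact: serre_quotient_locally_finite (mr_locally_finite hA).
- exact: serre_quotient_monoidal.
- exact: serre_quotient_tensor_bilinear.
- exact: serre_quotient_tensor_biexact.
Qed.
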